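(* Consider, for real parameters $\lambda,k$, the problem $$k^2(k^2u^2+u'^2)u-\bigl((k^2u^2+u'^2)u'\bigr)'=\lambda u^3\ \text{ in }(0,1),\qquad u(0)=u(1)=0.\qquad(\ast)$$ Then: (a) All eigen-parameters $(\lambda,k)$ with $k\ne0$ of problem $(\ast)$ satisfy $k^4<\lambda$. (b) For every $k\in\mathbb{R}$, the set of all eigenvalues $\lambda$ of problem $(\ast)$ consists of a sequence of positive numbers $\lambda_n(k)$ such that $\lambda_n(k)\to\infty$ as $n\to\infty$. There is a number $\lambda^*>0$ such that: (c) for each $\lambda$ with $\lambda^*\le\lambda$, the set of all eigen-parameters $k\ge0$ of problem $(\ast)$ (i.e. all $k\ge 0$ such that $(\lambda,k)$ is a pair of eigen-parameters) consists of a finite number of eigen-parameters $k_1(\lambda),k_2(\lambda),\dots,k_{n(\lambda)}(\lambda)$, which belong to the interval $[0,\lambda^{1/4}]$; moreover $n(\lambda)\to\infty$ as $\lambda\to\infty$; (d) if $\lambda<\lambda^*$, then for every $k\in\mathbb{R}$ problem $(\ast)$ has only the trivial solution.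
   Context: All functions are real-valued. A solution of $(\ast)$ is a function $u\in W_0^{1,4}(0,1)$ satisfying $$k^2\int_0^1(k^2u^2+u'^2)uv\,dx+\int_0^1(k^2u^2+u'^2)u'v'\,dx=\lambda\int_0^1u^3v\,dx\quad\text{for all }v\in W_0^{1,4}(0,1).$$ A pair $(\lambda,k)\in\mathbb{R}^2$ is called a pair of eigen-parameters of $(\ast)$ if $(\ast)$ has a nontrivial solution for these values; for fixed $k$ such a $\lambda$ is called an eigenvalue, and for fixed $\lambda$ such a $k$ is called an eigen-parameter. *)

(* Defs.v *)
From HB Require Import structures.
From mathcomp Require Import all_boot all_order all_algebra.
From mathcomp Require Import all_classical all_reals all_analysis.

Set Implicit Arguments.
Unset Strict Implicit.
Unset Printing Implicit Defensive.

Import Order.TTheory GRing.Theory Num.Theory.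
Import numFieldNormedType.Exports.

Local Open Scope classical_set_scope.
Local Open Scope ring_scope.

Section Sobolev.
Context {R : realType}.
Implicit Types u du v dv phi : R -> R.

Definition I01 : set R := `]0, 1[%classic.

(* C^1_c(0,1), each function being extended by 0 to the whole line. *)
Definition test_function phi : Prop :=
  [/\ forall x, derivable phi x 1,
      continuous (derive1 phi) &
      exists a b : R, [/\ 0 < a, b < 1 &
        forall x, x \notin `[a, b] -> phi x = 0]].

(* The L^4(0,1)-norm; only the values of u on (0,1) matter. *)
Definition L4norm u : \bar R :=
  'N[lebesgue_measure]_(4%:E)[EFin \o (u \_ I01)].

Definition L4 u : Prop :=
  measurable_fun I01 u /\ (L4norm u < +oo)%E.

Definition weak_derivative u du : Prop :=
  forall phi, test_function phi ->
    \int[lebesgue_measure]_(x in I01) (u x * derive1 phi x) =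
    - \int[lebesgue_measure]_(x in I01) (du x * phi x).

(* u represents an element of W^{1,4}(0,1) and du represents u'. *)
Definition W14 u du : Prop := [/\ L4 u, L4 du & weak_derivative u du].

(* W_0^{1,4}(0,1) is the closure of C^1_c(0,1) in W^{1,4}(0,1); taking
   C^1_c or C^oo_c test functions gives the same spaces (Brezis, "Functional
   Analysis, Sobolev Spaces and PDE", chapter 8). *)
Definition W014 u du : Prop :=
  W14 u du /\
  exists phi : nat -> R -> R,
    [/\ forall n, test_function (phi n),
        L4norm (fun x => phi n x - u x) @[n --> \oo] --> 0%E &
        L4norm (fun x => derive1 (phi n) x - du x) @[n --> \oo] --> 0%E].

End Sobolev.

Section Problem.
Context {R : realType}.
Implicit Types (lambda k : R) (u : R -> R).

(* du is a representative of u', which is unique up to null sets. *)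
Definition is_solution lambda k u : Prop :=
  exists2 du : R -> R, W014 u du &
    forall v dv : R -> R, W014 v dv ->
      k ^+ 2 * \int[lebesgue_measure]_(x in I01)
          ((k ^+ 2 * u x ^+ 2 + du x ^+ 2) * u x * v x)
      + \int[lebesgue_measure]_(x in I01)
          ((k ^+ 2 * u x ^+ 2 + du x ^+ 2) * du x * dv x)
      = lambda * \int[lebesgue_measure]_(x in I01) (u x ^+ 3 * v x).

Definition trivial u : Prop :=
  {ae lebesgue_measure, forall x, I01 x -> u x = 0}.

Definition eigen_parameters lambda k : Prop :=
  exists2 u, is_solution lambda k u & ~ trivial u.

End Problem.

(* Main.v *)
Require Import Defs.
From HB Require Import structures.
From mathcomp Require Import all_boot all_order all_algebra.
From mathcomp Require Import all_classical all_reals all_analysis.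
From mathcomp Require Import measurable_realfun ring lra.

(**
  The spectrum is explicit. A weak solution is, up to a null set, C^1 with
  (k^2 u^2 + u'^2) u' of class C^1 (du Bois-Reymond, then inversion of the
  cubic p |-> (k^2 u^2 + p^2) p), and testing the equation with u itself gives
  k^4 < lambda, say lambda = k^4 + 3 q^2 with q > 0. Put m = k^2 / 3. Between
  two zeros the slope p = u' / u satisfies an autonomous equation, from which
  p^4 + 2 m p^2 + q^2 times u^4 is constant and the distance of two consecutive
  zeros is pi sqrt ((q + m) / 2) / q, whatever the solution. Conversely, the
  substitution p = sqrt q cot t yields a solution on the whole line whose zeros
  in [0, oo) are the multiples of this half period J; when u(1) = 0, composing
  u with C^1 functions vanishing near 0 exhibits it as an element of W_0^{1,4}. Hence
  (lambda, k) is a pair of eigen-parameters iff n J = 1 for some n >= 1, that is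
  2 q^2 = (n pi)^2 (q + m). The positive root q_n(k) is increasing in n and |k|
  and lambda_n(k) = k^4 + 3 q_n(k)^2, so that lambda^* = lambda_1(0) and, for
  fixed lambda, k_n(lambda) exists iff lambda_n(0) <= lambda.
*)

Set Implicit Arguments.
Unset Strict Implicit.
Unset Printing Implicit Defensive.

Import Order.TTheory GRing.Theory Num.Theory.
Import numFieldNormedType.Exports.

Local Open Scope classical_set_scope.
Local Open Scope ring_scope.

(** The equation degenerates at k = 0: where u' = 0 and u != 0 the flux u'^3 has a nonzero
    derivative, so u' is not differentiable there and Cauchy uniqueness is not at hand. Every
    computation on the slope p therefore goes through S(p) = p^3 + 3 m p, the flux divided by u^3,
    which is differentiable along any solution wherever u does not vanish: S(p)' = -3 (p^4 + 2 m p^2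
    + q^2). The normalisations k^2 = 3 m and lambda = k^4 + 3 q^2 are those that give this form, and
    S'(p) = 3 (p^2 + m) vanishes at most at p = 0. In place of uniqueness, zeros are counted arch by
    arch: the conserved quantity makes the slope nonzero at both ends of an arch, which lets the
    next arch start. A priori a solution could vanish on a subinterval, so the count starts from a
    point where u is nonzero and propagates to 0 and, by reflection, to 1. The half period is the
    integral of a rational function of cos and sin, evaluated in closed form by pairing the angles t
    and pi / 2 - t. *)

Section Calculus.
Context {R : realType}.
Implicit Types (a b z dz f g p : R -> R).

(** * Monotonicity, change of variable and antiderivatives on the line *)

Lemma is_derive1_continuous f (x l : R) :
  is_derive x 1 f l -> {for x, continuous f}.
Proof.
move=> [df _]; apply/differentiable_continuous.
exact/derivable1_diffP.
Qed.

Lemma cvg_exprn (T : Type) (F : set_system T) {FF : Filter F} (f : T -> R)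
    (l : R) n : f x @[x --> F] --> l -> f x ^+ n @[x --> F] --> l ^+ n.
Proof.
move=> fl; elim: n => [|n IH]; first exact: cvg_cst.
by rewrite exprS; under eq_fun do rewrite exprS; exact: cvgM.
Qed.

Lemma near_right_segment (P : R -> Prop) (a b : R) : (\forall x \near a, P x) -> a < b ->
  exists2 y, a < y < b & forall x, a <= x <= y -> P x.
Proof.
move=> /nbhs_ballP[d /= d0 aP] ab.
exists (a + Num.min (d / 2) ((b - a) / 2)).
  have : 0 < Num.min (d / 2) ((b - a) / 2) by rewrite lt_min; lra.
  have : Num.min (d / 2) ((b - a) / 2) <= (b - a) / 2 by rewrite ge_min lexx orbT.
  lra.
move=> x /andP[ax xd]; apply: aP; rewrite /ball/= ltr_distlC.
have : Num.min (d / 2) ((b - a) / 2) <= d / 2 by rewrite ge_min lexx.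
lra.
Qed.

Lemma near_left_segment (P : R -> Prop) (a b : R) : (\forall x \near b, P x) -> a < b ->
  exists2 y, a < y < b & forall x, y <= x <= b -> P x.
Proof.
move=> /nbhs_ballP[d /= d0 bP] ab.
exists (b - Num.min (d / 2) ((b - a) / 2)).
  have : 0 < Num.min (d / 2) ((b - a) / 2) by rewrite lt_min; lra.
  have : Num.min (d / 2) ((b - a) / 2) <= (b - a) / 2 by rewrite ge_min lexx orbT.
  lra.
move=> x /andP[xd xb]; apply: bP; rewrite /ball/= ltr_distlC.
have : Num.min (d / 2) ((b - a) / 2) <= d / 2 by rewrite ge_min lexx.
lra.
Qed.

Lemma derive_ge0_le f (df : R -> R) (s t : R) :
  (forall x, s < x < t -> is_derive x 1 f (df x)) ->
  (forall x, s <= x <= t -> {for x, continuous f}) ->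
  (forall x, s < x < t -> 0 <= df x) -> s <= t -> f s <= f t.
Proof.
move=> fdf cf df0; rewrite le_eqVlt => /predU1P[->//|st].
have [x xst E] : exists2 c, c \in `]s, t[%R & f t - f s = df c * (t - s).
  apply: MVT => //.
  by apply: continuous_in_subspaceT => x; rewrite inE/= in_itv/=; exact: cf.
rewrite -subr_ge0 E mulr_ge0//; last by rewrite subr_ge0 ltW.
by apply: df0; move: xst; rewrite in_itv.
Qed.

Lemma derive_eq0_cst f (s t : R) :
  (forall x, s < x < t -> is_derive x 1 f 0) ->
  (forall x, s <= x <= t -> {for x, continuous f}) -> s <= t -> f s = f t.
Proof.
move=> fdf cf st; apply/eqP; rewrite eq_le; apply/andP; split.
  by apply: (derive_ge0_le (df := cst 0)).
rewrite -lerN2; apply: (@derive_ge0_le (fun x => - f x) (fun=> 0)) st => // x sxt.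
  by rewrite -oppr0; apply: is_deriveN; exact: fdf.
by apply: continuousN; exact: cf.
Qed.

(* If [a' = b z'] and [z' >= 0], then [a - (b (p x) +- e) z] are monotone near
   [p x], so the increments of [a] are [b (p x)] times those of [z] up to a
   factor [e]; [p] itself need not be differentiable. *)
Lemma is_derive_reparam a b z dz p (x l : R) :
  (forall t : R, is_derive t 1 a (b t * dz t)) ->
  (forall t : R, is_derive t 1 z (dz t)) -> (forall t, 0 <= dz t) ->
  {for p x, continuous b} -> {for x, continuous p} ->
  is_derive x 1 (z \o p) l -> is_derive x 1 (a \o p) (b (p x) * l).
Proof.
move=> aE zE dz0 cb cp /is_derive1_caratheodory[h [hE ch hl]].
set b0 := b (p x).
have key e : 0 < e -> \forall y \near x,
    `|(a (p y) - a (p x)) - b0 * (z (p y) - z (p x))| <= e * `|z (p y) - z (p x)|.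
  move=> e0.
  have [d d0 bd] : exists2 d, 0 < d & forall t, `|p x - t| < d -> `|b t - b0| <= e.
    have /cvgrPdist_le/(_ e e0)/nbhs_ballP[d /= d0 Hd] := cb.
    by exists d => // t /Hd; rewrite distrC.
  have mono (s t : R) : `|p x - s| < d -> `|p x - t| < d -> s <= t ->
      `|(a t - a s) - b0 * (z t - z s)| <= e * (z t - z s).
    move=> sd td st.
    have ud u : s <= u <= t -> `|b u - b0| <= e.
      move=> /andP[su ut]; apply: bd; move: sd td; rewrite !ltr_distl; lra.
    have dlin (c u : R) : is_derive u 1 (fun v => a v + c * z v) (b u * dz u + c * dz u).
      exact: is_deriveD.
    rewrite ler_norml; apply/andP; split.
      have := @derive_ge0_le (fun v => a v + (e - b0) * z v)
        (fun u => b u * dz u + (e - b0) * dz u) s t.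
      move=> /(_ (fun u _ => dlin _ u)
        (fun u _ => is_derive1_continuous (dlin (e - b0) u))) H.
      have : a s + (e - b0) * z s <= a t + (e - b0) * z t.
        apply: H => // u /andP[/ltW su /ltW ut].
        rewrite -mulrDl mulr_ge0//.
        by have := ud u; rewrite su ut ler_norml => /(_ isT); lra.
      lra.
    have := @derive_ge0_le (fun v => (e + b0) * z v - a v)
      (fun u => (e + b0) * dz u - b u * dz u) s t.
    have dlin' (u : R) : is_derive u 1 (fun v => (e + b0) * z v - a v)
       ((e + b0) * dz u - b u * dz u).
      exact: is_deriveB.
    move=> /(_ (fun u _ => dlin' u)
        (fun u _ => is_derive1_continuous (dlin' u))) H.
    have : (e + b0) * z s - a s <= (e + b0) * z t - a t.
      apply: H => // u /andP[/ltW su /ltW ut].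
      rewrite -mulrBl mulr_ge0//.
      by have := ud u; rewrite su ut ler_norml => /(_ isT); lra.
    lra.
  have zm s t : s <= t -> z s <= z t.
    apply: derive_ge0_le => // u _; exact: is_derive1_continuous (zE u).
  have /cvgrPdist_lt/(_ d d0) := cp.
  apply: filterS => y pyd.
  have pxd : `|p x - p x| < d by rewrite subrr normr0.
  have [le|/ltW le] := leP (p x) (p y).
    rewrite [`|z _ - z _|]ger0_norm; first exact: mono.
    by rewrite subr_ge0 zm.
  rewrite [`|z _ - z _|]distrC [`|z _ - z _|]ger0_norm; last by rewrite subr_ge0 zm.
  have := mono _ _ pyd pxd le.
  rewrite -normrN; congr (`|_| <= _); ring.
apply/is_derive1_caratheodory.
exists (fun y => if y == x then b0 * l else (a (p y) - a (p x)) / (y - x)).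
split.
- move=> y; case: eqP => [->|/eqP yx]; first by rewrite !subrr mulr0.
  by rewrite /= divfK// subr_eq0.
- rewrite /prop_for /continuous_at eqxx.
  apply/cvgrPdist_le => e e0.
  have e1 : 0 < e / 2 / (`|l| + 1) by rewrite divr_gt0 ?divr_gt0// ltr_wpDl.
  have e2 : 0 < e / 2 / (`|b0| + 1) by rewrite divr_gt0 ?divr_gt0// ltr_wpDl.
  (* The cap at 1 bounds [h y] by [|l| + 1], which pays for the first half of [e]; the other bound
     pays for [b0 * (h y - l)]. *)
  have hl1 : \forall y \near x, `|h y - l| <= Num.min 1 (e / 2 / (`|b0| + 1)).
    move: ch; rewrite /prop_for /continuous_at hl => /cvgrPdist_le.
    have m0 : 0 < Num.min 1 (e / 2 / (`|b0| + 1)) by rewrite lt_min ltr01.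
    by move=> /(_ _ m0); apply: filterS => y; rewrite distrC.
  near=> y.
  case: eqP => [_|/eqP yx]; first by rewrite subrr normr0 ltW.
  have yx0 : y - x != 0 by rewrite subr_eq0.
  have K : `|(a (p y) - a (p x)) - b0 * (z (p y) - z (p x))|
      <= e / 2 / (`|l| + 1) * `|z (p y) - z (p x)|.
    by near: y; exact: key.
  have : `|h y - l| <= Num.min 1 (e / 2 / (`|b0| + 1)) by near: y.
  rewrite le_min => /andP[H1 H2].
  have zh : z (p y) - z (p x) = h y * (y - x) by rewrite -hE.
  rewrite zh in K.
  have -> : b0 * l - (a (p y) - a (p x)) / (y - x) =
     - (((a (p y) - a (p x)) - b0 * (h y * (y - x))) / (y - x)) - b0 * (h y - l).
    by field.
  rewrite (le_trans (ler_normB _ _))// normrN normrM normfV normrM.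
  rewrite [leRHS]splitr lerD//.
    rewrite ler_pdivrMr ?normr_gt0// (le_trans K)// normrM mulrA.
    rewrite ler_wpM2r//.
    have hb : `|h y| <= `|l| + 1.
      by have := ler_normD (h y - l) l; rewrite subrK; lra.
    rewrite (le_trans (ler_wpM2l (ltW e1) hb))// divfK//.
  rewrite (le_trans (ler_wpM2l _ H2))//.
  rewrite mulrCA ler_piMr ?divr_ge0 ?(ltW e0)//.
  by rewrite ler_pdivrMr ?ltr_wpDl// mul1r lerDl.
- by rewrite eqxx.
Unshelve. all: by end_near. Qed.

(** The antiderivative is the signed integral from 0, a difference of two integrals of which one is
    over an empty interval. Near a given point it is re-based at an [s] below both 0 and that point,
    where the fundamental theorem applies. *)
Lemma continuous_antiderivative f : continuous f ->
  exists F : R -> R, forall x : R, is_derive x 1 F (f x).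
Proof.
move=> cf.
pose mu := @lebesgue_measure R.
have intf (u v : R) (b1 b2 : bool) :
    mu.-integrable [set` Interval (BSide b1 u) (BSide b2 v)] (EFin \o f).
  apply: (@integrableS _ _ _ mu `[u, v]) => //.
    by apply: subset_itvScc; rewrite bnd_simp.
  apply: continuous_compact_integrable => //; first exact: segment_compact.
  exact: continuous_subspaceT.
pose F x := \int[mu]_(t in `]0, x]) f t - \int[mu]_(t in `]x, 0]) f t.
have FE (s x : R) : s < 0 -> s < x ->
    F x = \int[mu]_(t in `]s, x]) f t - \int[mu]_(t in `]s, 0]) f t.
  move=> s0 sx; rewrite /F.
  have [x0|x0] := leP 0 x.
    rewrite (_ : [set` `]x, 0]] = set0) ?Rintegral_set0 ?subr0; last first.
      by apply/seteqP; split => // t /=; rewrite in_itv/=; lra.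
    by rewrite Rintegral_itvB// ?bnd_simp// ltW.
  rewrite (_ : [set` `]0, x]] = set0) ?Rintegral_set0 ?sub0r; last first.
    by apply/seteqP; split => // t /=; rewrite in_itv/=; lra.
  by rewrite -[RHS]opprB (@Rintegral_itvB R f (BRight s) (BRight 0) x)// ?bnd_simp ltW.
exists F => x.
pose s := - (`|x| + 1).
have sx : s < x by rewrite /s ltrNl; have := ler_norm (- x); rewrite normrN; lra.
have s0 : s < 0 by rewrite /s oppr_lt0 ltr_wpDl.
pose G y := \int[mu]_(t in `]s, y]) f t - \int[mu]_(t in `]s, 0]) f t.
have FG : \forall y \near x, F y = G y.
  near=> y; apply: FE => //.
  by near: y; apply: lt_nbhsr.
have xx1 : x < x + 1 by rewrite ltrDl.
have [dG GE] := @continuous_FTC1 R f (BRight s) x (x + 1) xx1 (intf _ _ _ _) sx (cf x).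
apply: (@near_eq_is_derive _ _ _ G).
  by apply: filterS FG => y ->.
rewrite -[f x]subr0; apply: is_deriveB.
by rewrite -GE derive1E; exact/derivableP.
Unshelve. all: by end_near. Qed.

End Calculus.

(** * The solution on the whole line and its half period *)

Section Arc.
Context {R : realType}.

Lemma sqr_cosD_sqr_sin_gt0 (c x : R) : 0 < c -> 0 < cos x ^+ 2 + c * sin x ^+ 2.
Proof.
move=> c0; have [s0|s0] := eqVneq (sin x) 0.
  by have := cos2Dsin2 x; rewrite s0 expr0n/= mulr0 !addr0 => ->.
by rewrite ltr_wpDl ?sqr_ge0// mulr_gt0// exprn_even_gt0.
Qed.

Variables m q : R.
Hypotheses (m0 : 0 <= m) (q0 : 0 < q).

Definition half_period : R := pi * Num.sqrt ((q + m) / 2) / q.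

Let h := Num.sqrt q.
Let mu := m / q.
(** With p = h cot t this is [sin t ^+ 4 / q ^+ 2] times p^4 + 2 m p^2 + q^2, so it stays smooth
    across the zeros of u, where p is infinite. *)
Let N (t : R) := cos t ^+ 4 + 2 * mu * cos t ^+ 2 * sin t ^+ 2 + sin t ^+ 4.

(* [d x / d t] along a solution whose logarithmic derivative is
   [u' / u = h cot t]. *)
Definition arc_speed (t : R) : R := (cos t ^+ 2 + mu * sin t ^+ 2) / (h * N t).

Let h0 : 0 < h. Proof. by rewrite sqrtr_gt0. Qed.
Let hE : h ^+ 2 = q. Proof. by rewrite sqr_sqrtr// ltW. Qed.
Let mu0 : 0 <= mu. Proof. by rewrite divr_ge0// ltW. Qed.
Let muE : m = mu * q. Proof. by rewrite divfK// gt_eqF. Qed.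

Let N_gt0 t : 0 < N t.
Proof.
have -> : N t = (cos t ^+ 2 - sin t ^+ 2) ^+ 2 / 2 + 2^-1 + 2 * mu * (cos t * sin t) ^+ 2.
  rewrite /N; have c2 : cos t ^+ 2 = 1 - sin t ^+ 2 by rewrite cos2sin2.
  by field: c2.
have := sqr_ge0 (cos t ^+ 2 - sin t ^+ 2).
have := mulr_ge0 (mulr_ge0 (ler0n R 2) mu0) (sqr_ge0 (cos t * sin t)); lra.
Qed.

Let is_derive_N (t : R) : is_derive t 1 N
  (4 * (mu - 1) * cos t * sin t * (cos t ^+ 2 - sin t ^+ 2)).
Proof.
apply: is_derive_eq; rewrite /GRing.scale/=.
ring: (cos2Dsin2 t).
Qed.

Let arc_speed_continuous : continuous arc_speed.
Proof.
move=> t.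
have nz : h * N t != 0 by rewrite mulf_neq0 ?gt_eqF.
have hN : is_derive t 1 (fun t => h * N t)
   (h * (4 * (mu - 1) * cos t * sin t * (cos t ^+ 2 - sin t ^+ 2))).
  exact: is_deriveZ.
have nume : is_derive t 1 (fun t => cos t ^+ 2 + mu * sin t ^+ 2)
    (2 * (mu - 1) * (cos t * sin t)).
  by apply: is_derive_eq; rewrite /GRing.scale/=; ring.
have := is_deriveM nume (is_deriveV (f := fun t => h * N t) nz hN).
exact: (@is_derive1_continuous R arc_speed).
Qed.

Let arc_speed_ge0 t : 0 <= arc_speed t.
Proof.
apply: divr_ge0; first by rewrite addr_ge0 ?sqr_ge0// mulr_ge0 ?sqr_ge0.
by rewrite mulr_ge0 ?ltW.
Qed.

Let arc_speedDpi t : arc_speed (t + pi) = arc_speed t.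
Proof.
rewrite /arc_speed /N sinDpi cosDpi.
have e4 (y : R) : (- y) ^+ 4 = y ^+ 4 by ring.
by rewrite !sqrrN !e4.
Qed.

(** [T] is the position x as a function of the angle t. Its increment over an angle pi is found by
    pairing t with pi / 2 - t: [N] is invariant, the two numerators add up to [1 + mu], and what is
    left integrates to an arctangent in 2 t. *)
Lemma arc_time_exists : exists T : R -> R,
  [/\ forall t : R, is_derive t 1 T (arc_speed t), T 0 = 0 &
      forall t, T (t + pi) = T t + half_period].
Proof.
have [T0 T0E] := continuous_antiderivative arc_speed_continuous.
pose T t := T0 t - T0 0.
have TE (t : R) : is_derive t 1 T (arc_speed t).
  by rewrite -[arc_speed t]subr0; exact: is_deriveB.
pose J := T pi - T 0.
have TJ t : T (t + pi) = T t + J.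
  suff : T (t + pi) - T t = T (0 + pi) - T 0 by rewrite add0r /J => <-; ring.
  apply: (@is_derive_0_is_cst _ (fun t => T (t + pi) - T t)) => s.
  have d1 : is_derive s 1 (fun t => T (t + pi)) (arc_speed s).
    have dp : is_derive s 1 (fun t : R => t + pi) 1.
      by apply: is_derive_eq; rewrite addr0.
    by rewrite -[arc_speed s]mulr1 -arc_speedDpi; apply: is_derive1_comp.
  by rewrite -(subrr (arc_speed s)); exact: is_deriveB.
exists T; split => //; first by rewrite /T subrr.
move=> t; rewrite TJ; congr (_ + _).
(* Chosen so that [N t] is cos^2 + a^2 sin^2 at the angle 2 t, and [1 + mu = 2 * a ^+ 2]. *)
pose a := Num.sqrt ((1 + mu) / 2).
have a0 : 0 < a by rewrite sqrtr_gt0 divr_gt0// ltr_wpDr.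
have aE : a ^+ 2 = (1 + mu) / 2 by rewrite sqr_sqrtr// divr_ge0// addr_ge0.
have JE : half_period = pi * a / h.
  rewrite /half_period; have -> : (q + m) / 2 = (h * a) ^+ 2.
    rewrite exprMn aE hE muE; by field.
  rewrite sqrtr_sqr ger0_norm ?mulr_ge0 ?ltW// -[X in _ / X]hE.
  field; exact: lt0r_neq0.
rewrite JE.
(* [A] lifts [atan (a tan x)] to the line. *)
pose D (x : R) := cos x ^+ 2 + a * sin x ^+ 2.
have D0 x : 0 < D x by exact: sqr_cosD_sqr_sin_gt0.
pose A (x : R) := x + atan ((a - 1) * sin x * cos x / D x).
have AE (x : R) : is_derive x 1 A (a / (cos x ^+ 2 + a ^+ 2 * sin x ^+ 2)).
  have dD : is_derive x 1 D (2 * (a - 1) * sin x * cos x).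
    by apply: is_derive_eq; rewrite /GRing.scale/=; ring.
  have nzD : D x != 0 by rewrite gt_eqF.
  have dDV := is_deriveV nzD dD.
  have E0 : 0 < cos x ^+ 2 + a ^+ 2 * sin x ^+ 2.
    by apply: sqr_cosD_sqr_sin_gt0; rewrite exprn_gt0.
  have F0 : D x ^+ 2 + ((a - 1) * sin x * cos x) ^+ 2 != 0.
    by rewrite gt_eqF// ltr_pwDl ?sqr_ge0// exprn_gt0.
  have F1 : D x ^+ 2 + ((a - 1) * sin x * cos x) ^+ 2 = cos x ^+ 2 + a ^+ 2 * sin x ^+ 2.
    by rewrite -[RHS]mul1r -[X in _ = X * _](cos2Dsin2 x) /D; ring.
  apply: is_derive_eq; rewrite /GRing.scale/=.
  transitivity (1 + (D x * ((a - 1) * (cos x ^+ 2 - sin x ^+ 2))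
      - 2 * (a - 1) * sin x * cos x * ((a - 1) * sin x * cos x)) /
    (D x ^+ 2 + ((a - 1) * sin x * cos x) ^+ 2)).
    by field; rewrite nzD F0.
  rewrite -F1; apply: (mulIf F0); rewrite mulrDl !divfK// mul1r.
  rewrite -[RHS]mulr1 -(expr1n _ 2) -[X in _ = _ * X ^+ 2](cos2Dsin2 x) /D; ring.
pose Z (t : R) := a / h * A (2 * t).
have ZE (s : R) : is_derive s 1 Z (arc_speed s + arc_speed (pi / 2 - s)).
  have d2 : is_derive s 1 (fun t : R => 2 * t) 2.
    by apply: is_derive_eq; rewrite /GRing.scale/= mulr1.
  have dA : is_derive s 1 (fun t => A (2 * t))
      (a / (cos (2 * s) ^+ 2 + a ^+ 2 * sin (2 * s) ^+ 2) * 2).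
    exact: (@is_derive1_comp _ A).
  apply: is_derive_eq; rewrite /GRing.scale/=.
  have E0 : 0 < cos (2 * s) ^+ 2 + a ^+ 2 * sin (2 * s) ^+ 2.
    by apply: sqr_cosD_sqr_sin_gt0; rewrite exprn_gt0.
  have NE : N s = cos (2 * s) ^+ 2 + a ^+ 2 * sin (2 * s) ^+ 2.
    rewrite /N aE (_ : 2 * s = s + s); last by ring.
    rewrite cosD sinD.
    have c2 : cos s ^+ 2 = 1 - sin s ^+ 2 by rewrite cos2sin2.
    by field: c2.
  have NpE : N (pi / 2 - s) = N s.
    rewrite /N -[pi / 2 - s]opprB cosN sinN cosBpihalf sinBpihalf opprK.
    ring.
  rewrite /arc_speed NpE NE.
  rewrite -[pi / 2 - s]opprB cosN sinN cosBpihalf sinBpihalf opprK.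

  set E := _ + _ in E0 *.
  rewrite -mulrDl.
  have -> : cos s ^+ 2 + mu * sin s ^+ 2 + (sin s ^+ 2 + mu * cos s ^+ 2)
      = (1 + mu) * (cos s ^+ 2 + sin s ^+ 2) by ring.
  have -> : 1 + mu = 2 * a ^+ 2 by rewrite aE; field.
  by rewrite cos2Dsin2 mulr1; field; rewrite !gt_eqF.
(* [Y] and [Z] have the same derivative. From 0 to pi, [Y] increases by twice the increment [J] of
   [T] over a period, since both t and pi / 2 - t run through an interval of length pi, while [Z]
   increases by [a / h * (2 * pi)]. *)
pose Y (t : R) := T t - T (pi / 2 - t).
have YE (s : R) : is_derive s 1 Y (arc_speed s + arc_speed (pi / 2 - s)).
  have dp : is_derive s 1 (fun t : R => pi / 2 - t) (-1).
    by rewrite -[X in is_derive _ _ _ X]sub0r; exact: is_deriveB.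
  have d1 : is_derive s 1 (fun t => T (pi / 2 - t)) (arc_speed (pi / 2 - s) * -1).
    exact: is_derive1_comp.
  have -> : arc_speed s + arc_speed (pi / 2 - s) = arc_speed s - arc_speed (pi / 2 - s) * -1.
    by ring.
  exact: is_deriveB.
have YZ : Y 0 - Z 0 = Y pi - Z pi.
  apply: (@is_derive_0_is_cst _ (fun t => Y t - Z t)) => s.
  rewrite -(subrr (arc_speed s + arc_speed (pi / 2 - s))); exact: is_deriveB.
have sin2p : sin (2 * pi) = 0 :> R by rewrite mulr_natl sin2pi.
have A0 : A (2 * 0) = 0 by rewrite /A mulr0 sin0 !(mulr0,mul0r) atan0 addr0.
have Api : A (2 * pi) = 2 * pi by rewrite /A sin2p !(mulr0,mul0r) atan0 addr0.
have := TJ (pi / 2 - pi); rewrite subrK.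
have := TJ 0; rewrite add0r.
move: YZ; rewrite /Y /Z A0 Api subr0.
set x1 := T 0; set x2 := T (pi / 2); set x3 := T pi; set x4 := T _.
move=> Y1 Y2 Y3.
have -> : pi * a / h = a / h * (2 * pi) / 2 by field; exact: lt0r_neq0.
lra.
Qed.

Lemma half_period_gt0 : 0 < half_period.
Proof.
by rewrite !mulr_gt0 ?invr_gt0 ?pi_gt0// sqrtr_gt0 divr_gt0// ltr_pwDl.
Qed.

(** When m = 0 the speed vanishes at the zeros of cos, so the sign of the derivative does not
    suffice. If [T s = T t], then [T] is constant on [s, t], cos vanishes on the open interval, and
    so does its derivative -sin at the midpoint, against cos^2 + sin^2 = 1. *)
Lemma arc_time_increasing (T : R -> R) (s t : R) :
  (forall t : R, is_derive t 1 T (arc_speed t)) -> s < t -> T s < T t.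
Proof.
move=> TE st.
have le x y : x <= y -> T x <= T y.
  apply: (derive_ge0_le (df := arc_speed)) => // z _.
  exact: is_derive1_continuous (TE z).
rewrite lt_neqAle le ?ltW// andbT; apply/negP => /eqP Tst.
have cos0 x : s < x < t -> cos x = 0.
  move=> /andP[sx xt].
  have : is_derive x 1 T 0.
    apply: near_eq_is_derive (is_derive_cst (T s) x 1).
    near=> y.
    have sy : s <= y by apply/ltW; near: y; exact: lt_nbhsr.
    have yt : y <= t by apply/ltW; near: y; exact: lt_nbhsl.
    by apply/eqP; rewrite eq_le le//= Tst le.
  move=> [_ D0]; have [_ D1] := TE x.
  have /eqP := etrans (esym D1) D0.
  rewrite mulf_eq0 invr_eq0 [X in _ || X]gt_eqF ?mulr_gt0// orbF.
  move=> /eqP c0; apply/eqP; rewrite -sqrf_eq0 eq_le sqr_ge0 andbT.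
  have := mulr_ge0 mu0 (sqr_ge0 (sin x)); lra.
pose c := (s + t) / 2.
have sc : s < c by rewrite /c; lra.
have ct : c < t by rewrite /c; lra.
have : is_derive c 1 (@cos R) 0.
  apply: near_eq_is_derive (is_derive_cst 0 c 1).
  near=> y; rewrite cos0//; apply/andP; split; near: y.
    exact: lt_nbhsr.
  exact: lt_nbhsl.
move=> [_ D0]; have [_ D1] := is_derive_cos c.
have /eqP := etrans (esym D1) D0; rewrite oppr_eq0 => /eqP s0.
have := cos2Dsin2 c; rewrite s0 cos0 ?sc// expr0n/= addr0 => /esym/eqP.
by rewrite oner_eq0.
Unshelve. all: by end_near. Qed.

(** The solution is parametrized by the angle: [th] inverts [T], and [U], [V] are u and u' as
    functions of t, with V / U = h cot t. Zeros of u are then the positions whose angle is a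
    multiple of pi, that is, the multiples of the half period. *)
Lemma arc_solution : exists u d : R -> R,
  [/\ forall x : R, is_derive x 1 u (d x), continuous d,
      forall x : R, is_derive x 1
        (fun x => (3 * m * u x ^+ 2 + d x ^+ 2) * d x)
        (- 3 * q ^+ 2 * u x ^+ 3 + 3 * m * u x * d x ^+ 2),
      forall n : nat, u (n%:R * half_period) = 0 &
      forall x, 0 <= x -> u x = 0 -> exists n : nat, x = n%:R * half_period].
Proof.
have [T [TE T0 TJ]] := arc_time_exists.
have Tlt s t : s < t -> T s < T t by exact: arc_time_increasing.
have Tn (n : nat) : T (n%:R * pi) = n%:R * half_period.
  elim: n => [|n IH]; first by rewrite !mul0r.
  by rewrite -natr1 !mulrDl !mul1r TJ IH.
have TNn (n : nat) : T (- (n%:R * pi)) = - (n%:R * half_period).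
  elim: n => [|n IH]; first by rewrite !mul0r !oppr0.
  have := TJ (- (n.+1%:R * pi)); rewrite -natr1 !mulrDl !mul1r.
  by rewrite (_ : - _ + pi = - (n%:R * pi)) ?IH; [lra|ring].
have cT (x : R) : {for x, continuous T} by exact: is_derive1_continuous (TE x).
have [th thE] : exists th : R -> R, forall x, T (th x) = x.
  suff ex x : exists t, T t = x by exists (fun x => sval (cid (ex x))) => x; case: cid.
  have J0 := half_period_gt0.
  pose n := (Num.truncn (`|x| / half_period)).+1.
  have xn : `|x| <= n%:R * half_period.
    rewrite -ler_pdivrMr//; apply/ltW/truncnS_gt.
  have n0 : 0 <= n%:R * pi :> R by rewrite mulr_ge0 ?pi_ge0.
  have [|||t _ tE] := @IVT R T (- (n%:R * pi)) (n%:R * pi) x.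
  - by lra.
  - exact: continuous_subspaceT.
  - rewrite TNn Tn; move: xn; rewrite ler_norml => /andP[x1 x2].
    by rewrite ge_min x1/= le_max x2 orbT.
  by exists t.
have thlt x y : x < T y -> th x < y.
  move=> xy; rewrite ltNge; apply/negP; rewrite le_eqVlt => /predU1P[E|/Tlt].
    by move: xy; rewrite E thE ltxx.
  by rewrite thE ltNge (ltW xy).
have thgt x y : T y < x -> y < th x.
  move=> xy; rewrite ltNge; apply/negP; rewrite le_eqVlt => /predU1P[E|/Tlt].
    by move: xy; rewrite -E thE ltxx.
  by rewrite thE ltNge (ltW xy).
have cth (x : R) : {for x, continuous th}.
  apply/cvgrPdist_lt => e e0; near=> y; rewrite distrC ltr_distl; apply/andP; split.
    apply: thgt; near: y; apply: lt_nbhsr.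
    by rewrite -[ltRHS]thE Tlt// ltrBlDr ltrDl.
  apply: thlt; near: y; apply: lt_nbhsl.
  by rewrite -[ltLHS]thE Tlt// ltrDl.
(* This is N^(-1/4), which makes the conserved quantity V^4 + 2 m V^2 U^2 + q^2 U^4 equal to q^2. *)
pose rho (t : R) := expR (- (ln (N t) / 4)).
have rho0 t : 0 < rho t by exact: expR_gt0.
have dN (t : R) := is_derive_N t.
have rhoE (t : R) : is_derive t 1 rho
    (- rho t * ((mu - 1) * cos t * sin t * (cos t ^+ 2 - sin t ^+ 2)) / N t).
  have dl := @is_derive1_ln R _ (N_gt0 t).
  have dlN : is_derive t 1 (fun t => ln (N t))
    ((N t)^-1 * (4 * (mu - 1) * cos t * sin t * (cos t ^+ 2 - sin t ^+ 2))).
    exact: is_derive1_comp.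
  apply: is_derive_eq; rewrite /GRing.scale/= /rho.
  by field; rewrite gt_eqF.
pose U t := rho t * sin t.
pose V t := h * (rho t * cos t).
have VE (t : R) : is_derive t 1 V (h * (rho t * - sin t +
    cos t * (- rho t * ((mu - 1) * cos t * sin t * (cos t ^+ 2 - sin t ^+ 2)) / N t))).
  by apply: is_derive_eq; rewrite /GRing.scale/=.
have cV : continuous V by move=> t; exact: is_derive1_continuous (VE t).
have UE (t : R) : is_derive t 1 U (V t * arc_speed t).
  apply: is_derive_eq; rewrite /GRing.scale/= /V /arc_speed.
  have Nt : N t != 0 by rewrite gt_eqF.
  have hn : h != 0 by rewrite gt_eqF.
  have NE : N t = (cos t ^+ 2 + mu * sin t ^+ 2) * (cos t ^+ 2 + sin t ^+ 2)
      + (mu - 1) * sin t ^+ 2 * (cos t ^+ 2 - sin t ^+ 2) by rewrite /N; ring.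
  rewrite cos2Dsin2 mulr1 in NE.
  transitivity (rho t * cos t *
      (N t - (mu - 1) * sin t ^+ 2 * (cos t ^+ 2 - sin t ^+ 2)) / N t).
    by field.
  by rewrite [in X in X / _]NE; field; rewrite Nt hn.
pose W t := (3 * m * U t ^+ 2 + V t ^+ 2) * V t.
pose G t := - 3 * q ^+ 2 * U t ^+ 3 + 3 * m * U t * V t ^+ 2.
have WE (t : R) : is_derive t 1 W (G t * arc_speed t).
  apply: is_derive_eq; rewrite /GRing.scale/= /G /arc_speed.
  have Nt : N t != 0 by rewrite gt_eqF.
  have hn : h != 0 by rewrite gt_eqF.
  rewrite /U /V muE -hE.
  have NE : N t = cos t ^+ 4 + 2 * mu * cos t ^+ 2 * sin t ^+ 2 + sin t ^+ 4 by [].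
  have c2 : cos t ^+ 2 = 1 - sin t ^+ 2 by rewrite cos2sin2.
  by field: c2 NE; rewrite Nt hn.
have cU : continuous U.
  by move=> t; exact: is_derive1_continuous (UE t).
(* For m = 0, [th] is continuous but may fail to be differentiable where the speed vanishes;
   [is_derive_reparam] asks only that [T \o th = id] have derivative 1. *)
have idE (x : R) : is_derive x 1 (T \o th) 1.
  rewrite (_ : T \o th = id); first exact: is_derive_id.
  by apply/funext => y /=.
exists (U \o th), (V \o th); split.
- move=> x; rewrite -[X in is_derive _ _ _ X]mulr1.
  by apply: (is_derive_reparam UE TE) => //; exact: cV.
- by move=> x; apply: continuous_comp; [exact: cth|exact: cV].
- move=> x; rewrite -[X in is_derive _ _ _ X]mulr1.
  apply: (is_derive_reparam WE TE) => //.
  apply: (@is_derive1_continuous _ G); typeclasses eauto.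
- move=> n /=; have -> : th (n%:R * half_period) = n%:R * pi.
    rewrite -Tn; apply/eqP; rewrite eq_le !leNgt; apply/andP.
    by split; apply/negP => /Tlt; rewrite thE ltxx.
  rewrite /U; have -> : sin (n%:R * pi) = 0 :> R; last by rewrite mulr0.
  elim: n => [|n IH]; first by rewrite mul0r sin0.
  by rewrite -natr1 mulrDl mul1r sinDpi IH oppr0.
- move=> x x0 /eqP; rewrite /= /U mulf_eq0 gt_eqF//= => /eqP s0.
  have th0 : 0 <= th x.
    by rewrite leNgt; apply/negP => /Tlt; rewrite T0 thE ltNge x0.
  (* The remainder of the angle modulo pi lies in [0, pi), where sin vanishes only at 0. *)
  pose n := Num.truncn (th x / pi).
  have /andP[n1 n2] := truncn_itv (divr_ge0 th0 (pi_ge0 R)).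
  rewrite -/n in n1 n2.
  have n1' : n%:R * pi <= th x by rewrite -ler_pdivlMr ?pi_gt0.
  have n2' : th x < n.+1%:R * pi by rewrite -ltr_pdivrMr ?pi_gt0.
  exists n; rewrite -[LHS]thE -Tn; congr T.
  have sshift k y : sin (y + k%:R * pi) = (-1) ^+ k * sin y :> R.
    elim: k => [|k IH]; first by rewrite mul0r addr0 mul1r.
    by rewrite -natr1 mulrDl mul1r addrA sinDpi IH exprS mulN1r mulNr.
  have := sshift n (th x - n%:R * pi); rewrite subrK s0 => /esym/eqP.
  rewrite mulf_eq0 signr_eq0/= => /eqP s1.
  apply/eqP; rewrite eq_le n1' andbT leNgt; apply/negP => lt.
  have : 0 < sin (th x - n%:R * pi).
    apply: sin_gt0_pi; rewrite subr_gt0 lt/= ltrBlDr.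
    by move: n2'; rewrite -natr1; lra.
  by rewrite s1 ltxx.
Unshelve. all: by end_near. Qed.

End Arc.

(** * Every classical solution has arches of the same length *)

Section NodalIntervals.
Context {R : realType}.

(** The sum [atan y + atan y^-1] has zero derivative for y > 0 and equals pi / 2 at 1. It serves to
    pass from the slope u' / u, infinite at a node, to its inverse. *)
Lemma atan_inv (y : R) : 0 < y -> pi / 2 - atan y = atan y^-1.
Proof.
move=> y0.
suff -> : pi / 2 = atan y + atan y^-1 by ring.
pose f (y : R) := atan y + atan y^-1.
have fE (x : R) : 0 < x -> is_derive x 1 f 0.
  move=> x0; have xn : x != 0 by rewrite gt_eqF.
  have dV : is_derive x 1 (fun x : R => x^-1) (- x ^- 2).
    have := @is_deriveV R id x 1 1 xn (is_derive_id x 1).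
    by rewrite /GRing.scale/= mulr1.
  have dA : is_derive x 1 (fun x => atan x^-1) ((1 + x^-1 ^+ 2)^-1 * - x ^- 2).
    exact: is_derive1_comp.
  have -> : 0 = (1 + x ^+ 2)^-1 + (1 + x^-1 ^+ 2)^-1 * - x ^- 2.
    have n1 : 1 + x ^+ 2 != 0 by rewrite gt_eqF// ltr_wpDr// sqr_ge0.
    have n2 : x ^+ 2 + 1 != 0 by rewrite addrC.
    by field; rewrite xn n2.
  exact: is_deriveD.
have f1 : f 1 = pi / 2.
  by rewrite /f invr1 atan1; field.
have fc s t : 0 < s -> s <= t -> f s = f t.
  move=> s0 st; apply: derive_eq0_cst => // x.
    by move=> /andP[sx _]; apply/fE/(lt_trans s0).
  by move=> /andP[sx _]; apply: is_derive1_continuous (fE x _); apply: lt_le_trans sx.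
rewrite -f1 -/(f y); have [y1|/ltW y1] := leP y 1; first exact/esym/fc.
exact: (fc 1).
Qed.

(** The zeros in [s, x0] form a nonempty compact set; [a] is its maximum. *)
Lemma last_zero (f : R -> R) (s x0 : R) : continuous f -> f s = 0 -> s <= x0 ->
  f x0 != 0 -> exists a, [/\ s <= a < x0, f a = 0 &
    forall x, a < x <= x0 -> f x != 0].
Proof.
move=> cf fs sx fx0.
pose A := `[s, x0]%classic `&` (f @^-1` [set 0]).
have cA : compact A.
  apply: (@subclosed_compact _ _ `[s, x0]); last by move=> x [].
    apply: closedI; first exact: interval_closed.
    by apply: closed_comp => // x _; exact: cf.
  exact: segment_compact.
have A0 : A !=set0 by exists s; split => //=; rewrite in_itv/= lexx.
have [a] := @compact_EVT_max R R id A A0 cA (continuous_subspaceT (fun x => cvg_id)).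
rewrite inE => -[/=]; rewrite in_itv/= => /andP[sa ax] fa amax.
have ax0 : a < x0 by rewrite lt_neqAle ax andbT; apply: contraNneq fx0 => <-; rewrite fa.
exists a; split => //; first by rewrite sa.
move=> x /andP[xa xx0]; apply/negP => /eqP fx.
have : x <= a.
  by apply: amax; rewrite inE; split => //=; rewrite in_itv/= xx0 (le_trans sa)// ltW.
by rewrite leNgt xa.
Qed.

Lemma first_zero (f : R -> R) (x0 s : R) : continuous f -> f s = 0 -> x0 <= s ->
  f x0 != 0 -> exists b, [/\ x0 < b <= s, f b = 0 &
    forall x, x0 <= x < b -> f x != 0].
Proof.
move=> cf fs sx fx0.
have cg : continuous (fun x => f (- x)).
  by move=> x; apply: continuous_comp; [exact: oppr_continuous|exact: cf].
have := @last_zero (fun x => f (- x)) (- s) (- x0) cg.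
rewrite !opprK lerN2 => /(_ fs sx fx0)[a [/andP[sa ax] fa H]].
exists (- a); split => //; first by rewrite ltrNr ax lerNl.
by move=> x /andP[x1 x2]; have := H (- x); rewrite opprK; apply; rewrite ltrNr x2 lerN2.
Qed.

Variables m q : R.
Hypotheses (m0 : 0 <= m) (q0 : 0 < q).
Let J := half_period m q.

(** The equation is kept in conservative form, with k^2 = 3 m and lambda = 9 m^2 + 3 q^2 inserted,
    since only the flux is known to be differentiable. Continuity is asked on the whole line so that
    the ends 0 and 1 call for no one-sided limits. *)
Definition classical_solution (U D : R -> R) : Prop :=
  [/\ continuous U, continuous D, U 0 = 0 /\ U 1 = 0,
      forall x : R, 0 < x < 1 -> is_derive x 1 U (D x) &
      forall x : R, 0 < x < 1 -> is_derive x 1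
        (fun x => (3 * m * U x ^+ 2 + D x ^+ 2) * D x)
        (- 3 * q ^+ 2 * U x ^+ 3 + 3 * m * U x * D x ^+ 2)].

Lemma classical_solutionN U D : classical_solution U D ->
  classical_solution (fun x => - U x) (fun x => - D x).
Proof.
move=> [cU cD [U0 U1] UE PE]; split.
- by move=> x; apply: continuousN; exact: cU.
- by move=> x; apply: continuousN; exact: cD.
- by rewrite U0 U1 oppr0.
- by move=> x x01; apply: is_deriveN; exact: UE.
- move=> x x01; have := is_deriveN (PE x x01).
  rewrite (_ : - _ = (fun x => (3 * m * (- U x) ^+ 2 + (- D x) ^+ 2) * - D x)); last first.
    by apply/funext => y; rewrite !sqrrN mulrN.
  by move/is_derive_eq; apply; ring.
Qed.

Lemma classical_solution_onem U D : classical_solution U D ->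
  classical_solution (fun x => U (1 - x)) (fun x => - D (1 - x)).
Proof.
move=> [cU cD [U0 U1] UE PE].
have d1 (x : R) : is_derive x 1 (fun x : R => 1 - x) (-1).
  by rewrite -[X in is_derive _ _ _ X]sub0r; exact: is_deriveB.
have c1 : continuous (fun x : R => 1 - x).
  by move=> x; exact: is_derive1_continuous (d1 x).
split.
- by move=> x; apply: continuous_comp; [exact: c1|exact: cU].
- move=> x; apply: cvgN.
  by apply: continuous_comp; [exact: c1|exact: cD].
- by rewrite subr0 subrr U0 U1.
- move=> x x01; rewrite -[- D _]mulrN1; apply: is_derive1_comp.
  by apply: UE; lra.
- move=> x x01.
  have x01' : 0 < 1 - x < 1 by lra.
  have dP := is_deriveN (@is_derive1_comp _ _ (fun x => 1 - x) x _ _ (PE _ x01') (d1 x)).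
  have -> : (fun x => (3 * m * U (1 - x) ^+ 2 + (- D (1 - x)) ^+ 2) * - D (1 - x)) =
    - ((fun x => (3 * m * U x ^+ 2 + D x ^+ 2) * D x) \o (fun x => 1 - x)).
    by apply/funext => y; rewrite sqrrN mulrN.
  by apply: (is_derive_eq dP); ring.
Qed.

(** Inside the arch (S p)' = -3 Q(p) for the slope p = D / U, so X(p) moves at unit speed: it is the
    arc time of the angle t with p = h cot t, and this angle runs from 0 at [a] to pi at [b]. The
    slopes at the ends are nonzero because the conserved quantity, positive inside, reduces there to
    D^4. *)
Lemma positive_arch U D (a b : R) : classical_solution U D ->
  0 <= a -> a < b -> b <= 1 -> U a = 0 -> U b = 0 ->
  (forall x, a < x < b -> 0 < U x) ->
  [/\ b - a = J, D a != 0 & D b != 0].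
Proof.
move=> [cU cD [U0 U1] UE PE] a0 ab b1 Ua Ub Upos.
have [T [TE T0 TJ]] := arc_time_exists m0 q0.
have in01 x : a < x < b -> 0 < x < 1 by lra.
pose h := Num.sqrt q.
have h0 : 0 < h by rewrite sqrtr_gt0.
have hE : h ^+ 2 = q by rewrite sqr_sqrtr// ltW.
pose Q (p : R) := p ^+ 4 + 2 * m * p ^+ 2 + q ^+ 2.
have Q0 p : 0 < Q p.
  rewrite /Q ltr_wpDl ?exprn_gt0// addr_ge0//; first by rewrite exprn_even_ge0.
  by rewrite mulr_ge0 ?sqr_ge0// mulr_ge0.
pose S (p : R) := p ^+ 3 + 3 * m * p.
pose dS (p : R) := 3 * (p ^+ 2 + m).
have SE (p : R) : is_derive p 1 S (dS p).
  by apply: is_derive_eq; rewrite /GRing.scale/= /dS; ring.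
have QE (p : R) : is_derive p 1 Q (4 / 3 * p * dS p).
  by apply: is_derive_eq; rewrite /GRing.scale/= /dS; field.
have dS0 p : 0 <= dS p by rewrite mulr_ge0 ?addr_ge0 ?sqr_ge0.
(* [pi / 2 - atan (p / h)] is the angle in (0, pi) whose cotangent is p / h. *)
pose X (p : R) := T (pi / 2 - atan (p / h)).
have XE (p : R) : is_derive p 1 X (- (3 * Q p)^-1 * dS p).
  have hn : h != 0 by rewrite gt_eqF.
  have dy : is_derive p 1 (fun p : R => p / h) h^-1.
    rewrite (_ : (fun p : R => p / h) = (fun p => h^-1 * p)); last first.
      by apply/funext => z; rewrite mulrC.
    by apply: is_derive_eq; rewrite /GRing.scale/= mulr1.
  have dt : is_derive p 1 (fun p : R => pi / 2 - atan (p / h))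
      (- ((1 + (p / h) ^+ 2)^-1 * h^-1)).
    rewrite -[X in is_derive _ _ _ X]sub0r; exact: is_deriveB.
  have := @is_derive1_comp _ T _ p _ _ (TE _) dt.
  move=> /is_derive_eq; apply.
  set y := p / h; have pE : p = h * y by rewrite /y; field.
  have c2 : cos (atan y) ^+ 2 = (1 + y ^+ 2)^-1.
    by rewrite cos_atan exprVn sqr_sqrtr// addr_ge0// sqr_ge0.
  have y1 : 1 + y ^+ 2 != 0 by rewrite gt_eqF// ltr_wpDr// sqr_ge0.
  have s2 : sin (atan y) ^+ 2 = y ^+ 2 * (1 + y ^+ 2)^-1.
    by rewrite sin2cos2 c2; field.
  have sE : cos (pi / 2 - atan y) = sin (atan y) by rewrite -cosN opprB cosBpihalf.
  have cE : sin (pi / 2 - atan y) = cos (atan y).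
    by rewrite -[pi / 2 - _]opprB sinN sinBpihalf opprK.
  have qn : q != 0 by rewrite gt_eqF.
  have p2 : p ^+ 2 = q * y ^+ 2 by rewrite pE -hE; ring.
  have p4 (z : R) : z ^+ 4 = (z ^+ 2) ^+ 2 by rewrite -exprM.
  have Qp : Q p = q ^+ 2 * (y ^+ 4 + 2 * (m / q) * y ^+ 2 + 1).
    by rewrite /Q p4 p2; field.
  have Qy : y ^+ 4 + 2 * (m / q) * y ^+ 2 + 1 != 0.
    by have := Q0 p; rewrite Qp; apply: contraTneq => ->; rewrite mulr0 ltxx.
  rewrite /arc_speed sE cE (p4 (sin _)) (p4 (cos _)) s2 c2 Qp /dS.
  rewrite p2 -/h -hE in qn Qy *.
  field; rewrite hn y1 andbT /=; apply: contra_neq Qy => E.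
  transitivity ((y ^+ 4 * h ^+ 2 + 2 * m * y ^+ 2 + h ^+ 2) / h ^+ 2); last first.
    by rewrite E mul0r.
  by field.
pose p x := D x / U x.
have cp x : a < x < b -> {for x, continuous p}.
  move=> xab; apply: continuousM; first exact: cD.
  by apply: continuousV; [rewrite gt_eqF ?Upos|exact: cU].
have SpE (x : R) : a < x < b -> is_derive x 1 (S \o p) (- (3 * Q (p x))).
  move=> xab; have Ux : U x != 0 by rewrite gt_eqF ?Upos.
  have Ux3 : U x ^+ 3 != 0 by rewrite expf_neq0.
  have dU := UE _ (in01 _ xab).
  have dU3 : is_derive x 1 (fun x => U x ^+ 3) (3 * U x ^+ 2 * D x).
    by apply: is_derive_eq; rewrite /GRing.scale/=; ring.
  have := is_deriveM (PE _ (in01 _ xab)) (is_deriveV (f := fun x => U x ^+ 3) Ux3 dU3).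
  move=> /is_derive_eq => /(_ (- (3 * Q (p x)))) H.
  apply: near_eq_is_derive (H _).
    near=> y.
    have Uy : U y != 0.
      rewrite gt_eqF// Upos//; apply/andP; split; near: y.
        by apply: lt_nbhsr; case/andP: xab.
      by apply: lt_nbhsl; case/andP: xab.
    transitivity ((3 * m * U y ^+ 2 + D y ^+ 2) * D y * (U y ^+ 3)^-1) => //.
    by rewrite /= /S /p; field.
  rewrite /GRing.scale/= /Q /p.
  by field.
have XpE (x : R) : a < x < b -> is_derive x 1 (X \o p) 1.
  move=> xab.
  have E : - (3 * Q (p x))^-1 * - (3 * Q (p x)) = 1.
    by rewrite mulrNN mulVf// gt_eqF// mulr_gt0.
  rewrite -[X in is_derive _ _ _ X]E.
  apply: (is_derive_reparam XE SE dS0 _ (cp _ xab) (SpE _ xab)).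
  have Qn : 3 * Q (p x) != 0 by rewrite gt_eqF// mulr_gt0.
  have dQ3 : is_derive (p x) 1 (fun p => 3 * Q p) (3 * (4 / 3 * p x * dS (p x))).
    exact: is_deriveZ.
  have := is_deriveN (is_deriveV (f := fun p => 3 * Q p) Qn dQ3).
  exact: (@is_derive1_continuous R (fun p => - (3 * Q p)^-1)).
(* This is U^4 Q(p) written without the quotient, so that it is continuous up to the endpoints. *)
pose H x := D x ^+ 4 + 2 * m * D x ^+ 2 * U x ^+ 2 + q ^+ 2 * U x ^+ 4.
have cH : continuous H.
  move=> x; apply: cvgD; [apply: cvgD|].
  - exact: cvg_exprn (cD x).
  - apply: cvgM; last exact: cvg_exprn (cU x).
    by apply: cvgM; [exact: cvg_cst|exact: cvg_exprn (cD x)].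
  - by apply: cvgM; [exact: cvg_cst|exact: cvg_exprn (cU x)].
have HE x : a < x < b -> H x = U x ^+ 4 * Q (p x).
  move=> xab; rewrite /H /Q /p; field.
  by rewrite gt_eqF ?Upos.
have dH (x : R) : a < x < b -> is_derive x 1 H 0.
  move=> xab.
  have QpE : is_derive x 1 (Q \o p) (4 / 3 * p x * - (3 * Q (p x))).
    apply: (is_derive_reparam QE SE dS0 _ (cp _ xab) (SpE _ xab)).
    by apply: cvgM; [exact: cvg_cst|exact: cvg_id].
  have dU := UE _ (in01 _ xab).
  have dU4 : is_derive x 1 (fun x => U x ^+ 4) (4 * U x ^+ 3 * D x).
    by apply: is_derive_eq; rewrite /GRing.scale/=; ring.
  have := is_deriveM dU4 QpE.
  move=> /is_derive_eq => /(_ 0) H0.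
  apply: near_eq_is_derive (H0 _).
    near=> y; rewrite HE//; apply/andP; split; near: y.
      by apply: lt_nbhsr; case/andP: xab.
    by apply: lt_nbhsl; case/andP: xab.
  have Ux : U x != 0 by rewrite gt_eqF ?Upos.
  rewrite /GRing.scale/=.
  have -> : D x = p x * U x by rewrite /p divfK.
  by field.
have Hc x : a <= x <= b -> H x = H a.
  move=> /andP[ax xb]; apply/esym; apply: derive_eq0_cst => // y /andP[ay yx].
    by apply: dH; rewrite ay (lt_le_trans yx).
  exact: cH.
pose c := (a + b) / 2.
have cab : a < c < b by rewrite /c; lra.
have Ha : 0 < H a.
  rewrite -(Hc c) ?HE//; last by lra.
  by rewrite mulr_gt0 ?exprn_gt0 ?Upos.
have Hb : 0 < H b by rewrite Hc// lexx ltW.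
have Da : D a != 0.
  by apply: contraTneq Ha => D0; rewrite /H D0 Ua !expr0n/= !(mulr0,addr0) ltxx.
have Db : D b != 0.
  by apply: contraTneq Hb => D0; rewrite /H D0 Ub !expr0n/= !(mulr0,addr0) ltxx.
split => //.
have ca : a < c by lra.
have cb : c < b by lra.
have Dapos : 0 < D a.
  rewrite lt_neqAle eq_sym Da/= leNgt; apply/negP => D0.
  have [y /andP[ay yc] Dy] := near_right_segment (cvgr_lt _ (cD a) _ D0) ca.
  have := @derive_ge0_le _ (fun x => - U x) (fun x => - D x) a y.
  rewrite Ua oppr0 => /(_ _ _ _ (ltW ay)) H1.
  have : 0 <= - U y.
    apply: H1 => x /andP[ax xy].
    - by apply: is_deriveN; apply: UE; lra.
    - by apply: cvgN; exact: cU.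
    - by rewrite oppr_ge0 ltW// Dy// !ltW.
  by rewrite oppr_ge0 leNgt Upos// ay; lra.
have Dbneg : D b < 0.
  rewrite lt_neqAle Db/= leNgt; apply/negP => D0.
  have [y /andP[cy yb] Dy] := near_left_segment (cvgr_gt _ (cD b) _ D0) cb.
  have := @derive_ge0_le _ U D y b.
  rewrite Ub => /(_ _ _ _ (ltW yb)) H1.
  have : U y <= 0.
    apply: H1 => x /andP[yx xb].
    - by apply: UE; lra.
    - exact: cU.
    - by rewrite ltW// Dy// !ltW.
  by rewrite leNgt Upos// yb; lra.
have dX1 (x : R) : a < x < b -> is_derive x 1 (fun x => (X \o p) x - x) 0.
  move=> xab; rewrite -(subrr (1 : R)).
  by have := is_deriveB (XpE _ xab) (is_derive_id x 1).
(* At the endpoints p is infinite, so [pi / 2 - atan (p / h)] is replaced by [s + atan (h * U / D)],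
   which is continuous there. The shift [s] is 0 where D > 0 and pi where D < 0; the values at [a]
   and [b] are [T 0 - a] and [T pi - b]. *)
pose F s x := T (s + atan (h * U x / D x)) - x.
have cF s x : D x != 0 -> {for x, continuous (F s)}.
  move=> Dx; apply: cvgB; last exact: cvg_id.
  apply: continuous_comp; last exact: is_derive1_continuous (TE _).
  apply: cvgD; first exact: cvg_cst.
  apply: continuous_comp; last exact: continuous_atan.
  apply: cvgM; first by apply: cvgM; [exact: cvg_cst|exact: cU].
  by apply: continuousV => //; exact: cD.
have F1E x : a < x < b -> 0 < D x -> F 0 x = X (p x) - x.
  move=> xab Dx; rewrite /F /X atan_inv ?divr_gt0 ?Upos// add0r.
  congr (T (atan _) - _); rewrite /p; field.
  by rewrite !gt_eqF ?Upos.
have F2E x : a < x < b -> D x < 0 -> F pi x = X (p x) - x.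
  move=> xab Dx; rewrite /F /X.
  have y0 : 0 < - (p x / h).
    by rewrite -mulNr divr_gt0// /p -mulNr divr_gt0 ?Upos// oppr_gt0.
  congr (T _ - _).
  have -> : h * U x / D x = - (- (p x / h))^-1.
    have Dn : D x != 0 by rewrite lt_eqF.
    have Un : U x != 0 by rewrite gt_eqF ?Upos.
    have hn : h != 0 by rewrite gt_eqF.
    by rewrite /p; field; rewrite Dn Un hn.
  by rewrite atanN -atan_inv// atanN; field.
have [y1 /andP[ay1 y1c] Dy1] := near_right_segment (cvgr_gt _ (cD a) _ Dapos) ca.
have [y2 /andP[cy2 y2b] Dy2] := near_left_segment (cvgr_lt _ (cD b) _ Dbneg) cb.
have E1 : F 0 a = F 0 y1.
  apply: derive_eq0_cst; last exact: ltW.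
    move=> x /andP[ax xy].
    have xab : a < x < b by lra.
    apply: near_eq_is_derive (dX1 _ xab); near=> y.
    have ya : a < y by near: y; exact: lt_nbhsr.
    have yy : y < y1 by near: y; exact: lt_nbhsl.
    by rewrite F1E//= ?Dy1//; lra.
  by move=> x xay; apply: cF; rewrite gt_eqF// Dy1.
have E2 : F pi y2 = F pi b.
  apply: derive_eq0_cst; last exact: ltW.
    move=> x /andP[ax xy].
    have xab : a < x < b by lra.
    apply: near_eq_is_derive (dX1 _ xab); near=> y.
    have ya : y2 < y by near: y; exact: lt_nbhsr.
    have yy : y < b by near: y; exact: lt_nbhsl.
    by rewrite F2E//= ?Dy2//; lra.
  by move=> x xay; apply: cF; rewrite lt_eqF// Dy2.
have E3 : X (p y1) - y1 = X (p y2) - y2.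
  apply: (@derive_eq0_cst R (fun x => (X \o p) x - x)).
  - by move=> x xy; apply: dX1; lra.
  - by move=> x xy; apply: is_derive1_continuous (dX1 x _); lra.
  - lra.
have y1ab : a < y1 < b by rewrite ay1 (lt_trans y1c).
have y2ab : a < y2 < b by rewrite y2b (lt_trans ca).
have Dy1' : 0 < D y1 by apply: Dy1; rewrite lexx ltW.
have Dy2' : D y2 < 0 by apply: Dy2; rewrite lexx ltW.
have : F 0 a = F pi b by rewrite E1 -E2 F1E// F2E.
have := TJ 0; rewrite add0r T0 add0r /F Ua Ub !(mulr0, mul0r) atan0 !addr0 T0 => ->.
by rewrite -/J; lra.
Unshelve. all: by end_near. Qed.

Lemma nodal_interval U D (x0 : R) : classical_solution U D ->
  0 < x0 < 1 -> U x0 != 0 -> exists a b,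
  [/\ 0 <= a < x0, x0 < b <= 1, U a = 0 /\ U b = 0,
      forall x, a < x < b -> U x != 0 & [/\ b - a = J, D a != 0 & D b != 0]].
Proof.
move=> sol /andP[x00 x01].
wlog : U D sol / 0 < U x0 => [wlg Ux0|Ux0 _].
  have [U0|U0] := ltP 0 (U x0); first exact: (wlg U D).
  have NU0 : 0 < - U x0 by rewrite oppr_gt0 lt_neqAle Ux0.
  have [|a [b [H1 H2 [Ha Hb] H4 [H5 H6 H7]]]] := wlg _ _ (classical_solutionN sol) NU0.
    by rewrite oppr_eq0.
  exists a, b; split => //.
  - by split; apply/eqP; rewrite -oppr_eq0 ?Ha ?Hb.
  - by move=> x /H4; rewrite oppr_eq0.
  - by split => //; rewrite -oppr_eq0.
have [cU _ [U0 U1] _ _] := sol.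
have nz : U x0 != 0 by rewrite gt_eqF.
have [a [/andP[a0 ax] Ua anz]] := last_zero cU U0 (ltW x00) nz.
have [b [/andP[xb b1] Ub bnz]] := first_zero cU U1 (ltW x01) nz.
have abnz x : a < x < b -> U x != 0.
  move=> /andP[x1 x2]; have [xx|/ltW xx] := leP x x0; first by apply: anz; rewrite x1.
  by apply: bnz; rewrite xx.
exists a, b; split; rewrite ?a0 ?xb//.
apply: (positive_arch sol) => //; first exact: lt_trans xb.
move=> x /andP[x1 x2]; rewrite lt_neqAle eq_sym abnz ?x1//= leNgt; apply/negP => Ux.
have key (s t : R) : a < s -> s <= t -> t < b -> Num.min (U s) (U t) < 0 ->
    0 < Num.max (U s) (U t) -> False.
  move=> as_ st tb mn mx.
  have [||c cst Uc] := @IVT R U s t 0 st.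
  - exact: continuous_subspaceT.
  - by rewrite !ltW.
  have /abnz/eqP : a < c < b.
    by move: cst; rewrite in_itv/= => /andP[/(lt_le_trans as_)-> /le_lt_trans->].
  by [].
have [xx|/ltW xx] := leP x x0.
  by apply: (key x x0); rewrite // ?gt_min ?lt_max ?Ux ?Ux0 ?orbT.
by apply: (key x0 x); rewrite // ?gt_min ?lt_max ?Ux ?Ux0 ?orbT.
Qed.

(** By the mean value theorem the nonzero slope keeps U from vanishing just to the left of [z], so
    the nodal interval of a nearby point ends exactly at [z]; its other end is again a zero of
    nonzero slope, at distance [J]. *)
Lemma left_of_zero U D (z : R) : classical_solution U D ->
  0 < z <= 1 -> U z = 0 -> D z != 0 ->
  [/\ J <= z, U (z - J) = 0 & D (z - J) != 0].
Proof.
move=> sol /andP[z0 z1] Uz Dz; have [cU cD [U0 U1] UE _] := sol.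
have [s /andP[s0 sz] Ds] := near_left_segment (cvgr_neq0 _ (cD z) Dz) z0.
have Unz x : s <= x < z -> U x != 0.
  move=> /andP[sx xz]; apply/negP => /eqP Ux.
  have [c||c cx Ec] := @MVT R U D x z xz.
  - rewrite in_itv/= => /andP[xc cz]; apply: UE.
    by rewrite (lt_le_trans cz)// (lt_trans _ xc)// (lt_le_trans s0).
  - exact: continuous_subspaceT.
  move: Ec; rewrite Uz Ux subrr => /esym/eqP; rewrite mulf_eq0 [X in _ || X]gt_eqF ?subr_gt0// orbF.
  move: cx; rewrite in_itv/= => /andP[/ltW xc /ltW cz].
  by apply/negP/Ds; rewrite cz (le_trans sx).
have s01 : 0 < s < 1 by rewrite s0 (lt_le_trans sz).
have sU : U s != 0 by apply: Unz; rewrite lexx.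
have [a [b [/andP[a0 as_] /andP[sb b1] [Ua Ub] abnz [baJ Da Db]]]] := nodal_interval sol s01 sU.
have bz : b = z.
  apply/eqP; rewrite eq_le; apply/andP; split; rewrite leNgt; apply/negP => lt.
    have : U z != 0 by apply: abnz; rewrite lt (lt_trans as_).
    by rewrite Uz eqxx.
  have : U b != 0 by apply: Unz; rewrite lt ltW.
  by rewrite Ub eqxx.
have zJ : z - J = a by rewrite -bz -baJ; ring.
by rewrite zJ; split => //; rewrite -subr_ge0 zJ.
Qed.

(** Descent to the left by steps of [J]: a positive zero of nonzero slope is at least [J], so the
    descent can only stop at 0. An [n] with z < n J bounds the number of steps. *)
Lemma zeros_multiple U D (z : R) : classical_solution U D ->
  0 <= z <= 1 -> U z = 0 -> D z != 0 -> exists j : nat, z = j%:R * J.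
Proof.
move=> sol z01 Uz Dz.
have J0 : 0 < J by exact: half_period_gt0.
have : z < (Num.truncn (z / J)).+1%:R * J by rewrite -ltr_pdivrMr// truncnS_gt.
move: (Num.truncn _).+1 => n zn.
elim: n z z01 Uz Dz zn => [|n IH] z /andP[z0 z1] Uz Dz.
  by rewrite mul0r ltNge z0.
move: z0; rewrite le_eqVlt => /predU1P[<- _|z0 zn]; first by exists 0%N; rewrite mul0r.
have [|Jz UJ DJ] := left_of_zero sol _ Uz Dz; first by rewrite z0.
have [||j jE] := IH (z - J) _ UJ DJ.
- by rewrite subr_ge0 Jz (le_trans _ z1)// gerBl ltW.
- by rewrite ltrBlDr (lt_le_trans zn)// -natr1 mulrDl mul1r.
- by exists j.+1; rewrite -natr1 mulrDl mul1r -jE subrK.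
Qed.

(** Zeros are counted from the right end [b] of one nodal interval: b is a multiple of [J] by
    descent to 0, and 1 - b by the same descent for the reflected solution. Since b > 0, the total
    number of arches is at least 1. *)
Lemma classical_solution_period U D : classical_solution U D ->
  (exists2 x, 0 < x < 1 & U x != 0) -> exists n : nat, 1 = n.+1%:R * J.
Proof.
move=> sol [x x01 Ux].
have [a [b [/andP[a0 ax] /andP[xb b1] [Ua Ub] _ [_ Da Db]]]] := nodal_interval sol x01 Ux.
have b0 : 0 < b by case/andP: x01 => x0 _; exact: lt_trans xb.
have [|i iE] := zeros_multiple sol _ Ub Db; first by rewrite b1 ltW.
have [|||j jE] := zeros_multiple (z := 1 - b) (classical_solution_onem sol).
- by lra.
- by rewrite opprB addrC subrK.
- by rewrite opprB addrC subrK oppr_eq0.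
have : 1 = (i + j)%:R * J by rewrite natrD mulrDl -iE -jE; ring.
have i0 : i != 0%N by apply: contraTneq b0 => i0; rewrite iE i0 mul0r ltxx.
by exists (i + j).-1; rewrite prednK// addn_gt0 lt0n i0.
Qed.

End NodalIntervals.

(** * Integrability and convergence in L^4(0,1) *)

Section L4Space.
Context {R : realType}.
Local Notation mu := (@lebesgue_measure R).
Implicit Types u v w z f g phi : R -> R.

(* [lebesgue_measure] lives on [measurableTypeR R], whose display differs from
   the one inferred for [R]. *)
Lemma measurable_I01 : measurable (I01 : set (measurableTypeR R)).
Proof. exact: measurable_itv. Qed.
Hint Resolve measurable_I01 : core.

Local Notation integrable01 f := (mu.-integrable I01 (EFin \o f)).

Lemma lebesgue_aeS (P Q : R -> Prop) : (forall x, P x -> Q x) ->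
  {ae mu, forall x, P x} -> {ae mu, forall x, Q x}.
Proof.
move=> PQ; apply: filterS; first exact: (ae_filter_ringOfSetsType mu).
exact: PQ.
Qed.

Lemma lebesgue_aeS2 (P Q S : R -> Prop) : (forall x, P x -> Q x -> S x) ->
  {ae mu, forall x, P x} -> {ae mu, forall x, Q x} -> {ae mu, forall x, S x}.
Proof.
move=> PQS; apply: filterS2; first exact: (ae_filter_ringOfSetsType mu).
exact: PQS.
Qed.

Lemma eq_integrable01 f g : (forall x, I01 x -> f x = g x) ->
  integrable01 f -> integrable01 g.
Proof.
move=> fg; apply: eq_integrable => // x; rewrite inE => Ix /=.
by rewrite fg.
Qed.

Lemma integrable01D f g : integrable01 f -> integrable01 g ->
  integrable01 (fun x => f x + g x).
Proof.
move=> i1 i2; have := integrableD measurable_I01 i1 i2.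
by apply: eq_integrable.
Qed.

Lemma integrable01B f g : integrable01 f -> integrable01 g ->
  integrable01 (fun x => f x - g x).
Proof.
move=> i1 i2; have := integrableB measurable_I01 i1 i2.
by apply: eq_integrable.
Qed.

Lemma integrable01Z (c : R) f : integrable01 f -> integrable01 (fun x => c * f x).
Proof.
move=> i1; have := integrableZl measurable_I01 c i1.
by apply: eq_integrable.
Qed.

Lemma measurable_integrable01 f : integrable01 f -> measurable_fun I01 f.
Proof. by move=> /integrableP[/measurable_EFinP mf _]; exact: mf. Qed.

Lemma le_integrable01 f g : measurable_fun I01 f ->
  (forall x, I01 x -> `|f x| <= g x) -> integrable01 g -> integrable01 f.
Proof.
move=> mf fg ig; apply: (le_integrable measurable_I01 _ _ ig).
  by apply/measurable_EFinP; exact: mf.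
by move=> x Dx /=; rewrite lee_fin (le_trans (fg _ Dx))// ler_norm.
Qed.

Lemma lebesgue_measure_I01 : mu (@I01 R) = 1%:E.
Proof. by rewrite /I01 lebesgue_measure_itv/= lte_fin ltr01 oppr0 adde0. Qed.

Lemma I01_ltoo : (mu (@I01 R) < +oo)%E.
Proof. by rewrite lebesgue_measure_I01 ltry. Qed.

Lemma L4norm_poweR4 u :
  (L4norm u `^ 4 = \int[mu]_(x in I01) ((u x) ^+ 4)%:E)%E.
Proof.
rewrite /L4norm poweR_Lnorm ?pnatr_eq0//.
rewrite [RHS]integral_mkcond; apply: eq_integral => x _.
rewrite /= !patchE; case: ifPn => _ /=; last by rewrite normr0 powR0 ?pnatr_eq0.
by rewrite powR_mulrn// -normrX ger0_norm// exprn_even_ge0.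
Qed.

Lemma L4P u : L4 u <->
  measurable_fun I01 u /\ mu.-integrable I01 (EFin \o (fun x => u x ^+ 4)).
Proof.
have E : (\int[mu]_(x in I01) `|(u x ^+ 4)%:E| =
    L4norm u `^ 4)%E.
  rewrite L4norm_poweR4; apply: eq_integral => x _.
  by rewrite /= ger0_norm// exprn_even_ge0.
split=> -[mu_ H]; split => //.
  apply/integrableP; split.
    by apply/measurable_EFinP; exact: measurable_funX.
  by rewrite E poweR_lty.
move/integrableP : H => [_]; rewrite E; apply: lty_poweRy.
by rewrite pnatr_eq0.
Qed.

Lemma mul4_le_pow4 (a b c d : R) :
  `|a * b * c * d| <= a ^+ 4 + b ^+ 4 + c ^+ 4 + d ^+ 4.
Proof.
have sq (x y : R) : `|x * y| <= (x ^+ 2 + y ^+ 2) / 2.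
  rewrite ler_norml; have := sqr_ge0 (x + y); have := sqr_ge0 (x - y).
  by rewrite !expr2 => H1 H2; apply/andP; split; lra.
have sq4 (x : R) : x ^+ 4 = (x ^+ 2) ^+ 2 by rewrite -exprM.
have H1 := sq (a * b) (c * d).
have H2 : a ^+ 2 * b ^+ 2 <= (a ^+ 4 + b ^+ 4) / 2.
  by rewrite !sq4 (le_trans _ (sq _ _))// ler_norm.
have H3 : c ^+ 2 * d ^+ 2 <= (c ^+ 4 + d ^+ 4) / 2.
  by rewrite !sq4 (le_trans _ (sq _ _))// ler_norm.
rewrite -mulrA (le_trans H1)// !exprMn.
have p4 (x : R) : 0 <= x ^+ 4 by rewrite exprn_even_ge0.
have := p4 a; have := p4 b; have := p4 c; have := p4 d; lra.
Qed.

(** All integrands of the problem are combinations of products of four L4 functions, some of which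
    may be the constant 1; the sum of the four fourth powers dominates such a product. *)
Lemma L4_integrable_mul4 u v w z : L4 u -> L4 v -> L4 w -> L4 z ->
  mu.-integrable I01 (EFin \o (fun x => u x * v x * w x * z x)).
Proof.
move=> /L4P[mu_ iu] /L4P[mv iv] /L4P[mw iw] /L4P[mz iz].
apply: (@le_integrable01 _ (fun x => u x ^+ 4 + v x ^+ 4 + w x ^+ 4 + z x ^+ 4)).
- by do !apply: measurable_funM.
- by move=> x _; exact: mul4_le_pow4.
- by do !apply: integrable01D.
Qed.

Lemma bounded_measurable_L4 u (M : R) : measurable_fun I01 u ->
  (forall x, I01 x -> `|u x| <= M) -> L4 u.
Proof.
move=> mu_ uM; apply/L4P; split => //.
apply: measurable_bounded_integrable => //; first exact: I01_ltoo.
  exact: measurable_funX.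
exists (M ^+ 4); split; first exact: num_real.
move=> N MN x Ix; rewrite /= normrX (le_trans _ (ltW MN))//.
by apply: lerXn2r; rewrite ?nnegrE ?uM// (le_trans _ (uM _ Ix)).
Qed.

Lemma L4_cst1 : L4 (fun=> 1 : R).
Proof.
apply: (@bounded_measurable_L4 _ 1); first exact: measurable_cst.
by move=> x _; rewrite normr1.
Qed.

Lemma L4_integrable u : L4 u -> mu.-integrable I01 (EFin \o u).
Proof.
move=> uL; have := L4_integrable_mul4 uL L4_cst1 L4_cst1 L4_cst1.
by apply: eq_integrable => // x _ /=; rewrite !mulr1.
Qed.

Lemma continuous_measurable_I01 u : continuous u -> measurable_fun (@I01 R) u.
Proof.
move=> cu; apply: measurable_funTS; exact: continuous_measurable_fun.
Qed.

Lemma continuous_bounded_I01 u : continuous u ->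
  exists2 M, 0 < M & forall x, I01 x -> `|u x| <= M.
Proof.
move=> cu.
have cn : {within `[0, 1], continuous (fun x => `|u x|)}.
  apply: continuous_subspaceT => x.
  by apply: continuous_comp; [exact: cu|exact: norm_continuous].
have [c _ cmax] := EVT_max ler01 cn.
exists (`|u c| + 1) => [|x]; first by rewrite ltr_wpDl.
rewrite /I01/= in_itv/= => /andP[x0 x1].
by rewrite (le_trans (cmax _ _)) ?lerDl// in_itv/= !ltW.
Qed.

Lemma continuous_L4 u : continuous u -> L4 u.
Proof.
move=> cu; have [M _ uM] := continuous_bounded_I01 cu.
by apply: bounded_measurable_L4 uM; exact: continuous_measurable_I01.
Qed.

Lemma integrable01_mul_continuous f g : integrable01 f -> continuous g ->
  integrable01 (fun x => f x * g x).
Proof.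
move=> fi cg; have [M _ gM] := continuous_bounded_I01 cg.
apply: (@le_integrable01 _ (fun x => M * `|f x|)).
- apply: measurable_funM; first exact: measurable_integrable01.
  exact: continuous_measurable_I01.
- by move=> x Ix; rewrite normrM mulrC ler_wpM2r// gM.
- by apply: integrable01Z; exact: integrable_norm.
Qed.

(** On a set of measure 1 the L4-norm controls the L1-norm. Membership in L4 is part of the
    conclusion because finiteness of the norm is known only for large [n]. *)
Lemma L4norm_cvg0_L1 (f : nat -> R -> R) :
  (forall n, measurable_fun I01 (f n)) -> L4norm (f n) @[n --> \oo] --> 0%E ->
  forall e, 0 < e -> \forall n \near \oo,
    L4 (f n) /\ \int[mu]_(x in I01) `|f n x| <= e.
Proof.
move=> mf /fine_cvgP[ffin f0] e e0.
have e2 : 0 < e / 2 by rewrite divr_gt0.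
have fe : \forall n \near \oo, fine (L4norm (f n)) <= e / 2.
  move/cvgrPdist_le : f0 => /(_ _ e2); apply: filterS => n.
  by rewrite sub0r normrN => /ler_normlW.
near=> n.
have fn : L4norm (f n) \is a fin_num by near: n.
have fl : fine (L4norm (f n)) <= e / 2 by near: n.
have L4n : L4 (f n) by split => //; rewrite ltey_eq fn.
split => //.
have [_ i4] := (L4P _).1 L4n.
have i1 := L4_integrable L4n.
have I4 : \int[mu]_(x in I01) (f n x ^+ 4) <= (e / 2) ^+ 4.
  rewrite /Rintegral -L4norm_poweR4 fine_poweR.
  rewrite -powR_mulrn; last exact: ltW.
  by apply: ge0_ler_powR => //; rewrite ?nnegrE ?fine_ge0 ?Lnorm_ge0// ltW.
(* [t <= s + t^4 / s^3] with [s = e / 2] *)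
have young (t : R) : `|t| <= e / 2 + t ^+ 4 / (e / 2) ^+ 3.
  have [te|te] := leP `|t| (e / 2).
    rewrite ler_wpDr//; apply: divr_ge0; first by rewrite exprn_even_ge0.
    by rewrite exprn_ge0// ltW.
  rewrite ler_wpDl ?(ltW e2)// ler_pdivlMr ?exprn_gt0//.
  have -> : t ^+ 4 = `|t| * `|t| ^+ 3 by rewrite -exprS -normrX ger0_norm// exprn_even_ge0.
  by apply: ler_wpM2l => //; apply: lerXn2r; rewrite ?nnegrE// ltW.
have ic : mu.-integrable I01 (EFin \o (fun=> e / 2)).
  apply: measurable_bounded_integrable => //; first exact: I01_ltoo.
  exact: bounded_cst.
have i5 : integrable01 (fun x => f n x ^+ 4 / (e / 2) ^+ 3).
  by apply: eq_integrable01 (integrable01Z ((e / 2) ^+ 3)^-1 i4) => x _; rewrite mulrC.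
apply: (@le_trans _ _ (\int[mu]_(x in I01) (e / 2 + f n x ^+ 4 / (e / 2) ^+ 3))).
  apply: le_Rintegral => //; first exact: integrable_norm.
  exact: integrable01D ic i5.
rewrite RintegralD// RintegralZr// Rintegral_cst//.
have -> : fine (mu (@I01 R)) = 1 by rewrite lebesgue_measure_I01.
by rewrite mulr1 [leRHS]splitr lerD2l ler_pdivrMr ?exprn_gt0.
Unshelve. all: by end_near. Qed.

(** Dominated convergence applied to the fourth powers, then the monotonicity of the fourth root. *)
Lemma bounded_pointwise_L4norm_cvg0 (f : nat -> R -> R) (M : R) :
  (forall n, measurable_fun I01 (f n)) ->
  (forall n x, I01 x -> `|f n x| <= M) ->
  {ae mu, forall x, I01 x -> f n x @[n --> \oo] --> 0} ->
  L4norm (f n) @[n --> \oo] --> 0%E.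
Proof.
move=> mf fM f0.
have i0 : (\int[mu]_(x in I01) (f n x ^+ 4)%:E)%E @[n --> \oo] --> 0%E.
  have iM : integrable01 (fun=> M ^+ 4).
    apply: measurable_bounded_integrable => //; first exact: I01_ltoo.
    exact: bounded_cst.
  have p1 n : measurable_fun (I01 : set (measurableTypeR R)) (fun x => (f n x ^+ 4)%:E).
    by apply/measurable_EFinP; apply: measurable_funX; exact: mf.
  have p2 : {ae mu, forall x, I01 x -> (f n x ^+ 4)%:E @[n --> \oo] --> (0 : \bar R)}.
    apply: lebesgue_aeS f0 => x fx Ix; apply: cvg_EFin; first exact: nearW.
    have E : (0 : R) ^+ 4 = 0 by rewrite expr0n.
    by rewrite -[X in _ --> X]E; exact: cvg_exprn (fx Ix).
  have p3 : {ae mu, forall x n, I01 x -> (`|(f n x ^+ 4)%:E| <= (M ^+ 4)%:E)%E}.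
    apply: aeW => x n Ix; rewrite /= lee_fin normrX.
    by apply: lerXn2r; rewrite ?nnegrE ?fM// (le_trans _ (fM n _ Ix)).
  have [_ _] := dominated_convergence measurable_I01 p1 (measurable_cst (0 : \bar R)) p2 iM p3.
  by rewrite integral0.
have -> : (fun n => L4norm (f n)) =
    (fun n => (\int[mu]_(x in I01) (f n x ^+ 4)%:E) `^ (4^-1))%E.
  apply/funext => n; rewrite -L4norm_poweR4 -poweRrM mulfV ?pnatr_eq0// poweRe1//.
  exact: Lnorm_ge0.
move/fine_cvgP : i0 => [ifin i0]; apply/fine_cvgP; split.
  by apply: filterS ifin => n; exact: fin_num_poweR.
apply/cvgrPdist_le => e e0.
have e4 : 0 < e ^+ 4 by rewrite exprn_gt0.
move/cvgrPdist_le : i0 => /(_ _ e4); apply: filterS => n.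
rewrite !sub0r !normrN /= fine_poweR => /ler_normlW H.
have I0 : 0 <= fine (\int[mu]_(x in I01) (f n x ^+ 4)%:E).
  by rewrite fine_ge0// integral_ge0// => x _; rewrite lee_fin exprn_even_ge0.
rewrite ger0_norm ?powR_ge0//.
have -> : e = (e ^+ 4) `^ 4^-1.
  by rewrite -powR_mulrn ?(ltW e0)// -powRrM mulfV ?pnatr_eq0// powRr1// ltW.
by apply: ge0_ler_powR; rewrite ?nnegrE ?invr_ge0// ltW.
Qed.

End L4Space.

(** * Primitives of integrable functions and the du Bois-Reymond lemma *)

Section Primitive.
Context {R : realType}.
Local Notation mu := (@lebesgue_measure R).
Local Notation integrable01 f := (mu.-integrable I01 (EFin \o f)).
Implicit Types f g phi : R -> R.
Hint Resolve measurable_I01 : core.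

(** The cut-off outside (0, 1) and the lower bound -oo make the primitive a continuous function on
    the whole line, zero up to 0 and constant from 1 on. *)
Definition primitive f (x : R) : R := \int[mu]_(t in `]-oo, x]) (f \_ I01) t.

Lemma integrable01_restrict f : integrable01 f ->
  forall D : set (measurableTypeR R), measurable D ->
  mu.-integrable D (EFin \o (f \_ I01)).
Proof.
move=> fi D mD; apply: (@integrableS _ _ _ mu setT) => //.
rewrite -restrict_EFin.
have [H _] := integrable_mkcond (mu := mu) (EFin \o f) measurable_I01.
exact: H.
Qed.

Lemma primitiveE f (x : R) :
  primitive f x = \int[mu]_(t in `]-oo, x] `&` I01) f t.
Proof. by rewrite Rintegral_mkcondr. Qed.

Lemma primitive_le0 f (x : R) : x <= 0 -> primitive f x = 0.
Proof.
move=> x0; rewrite primitiveE (_ : _ `&` _ = set0) ?Rintegral_set0//.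
by apply/seteqP; split => // t; rewrite /I01/= !in_itv/=; lra.
Qed.

Lemma primitive_ge1 f (x : R) : 1 <= x -> primitive f x = \int[mu]_(t in I01) f t.
Proof.
move=> x1; rewrite primitiveE (_ : _ `&` _ = I01)//.
by apply/seteqP; split => t; rewrite /I01/= !in_itv/=; [case|split => //; lra].
Qed.

Lemma primitiveB f (x y : R) : integrable01 f -> x <= y ->
  primitive f y - primitive f x = \int[mu]_(t in `]x, y]) (f \_ I01) t.
Proof.
move=> fi xy; apply: Rintegral_itvB => //.
exact: integrable01_restrict.
Qed.

Lemma primitive_continuous f : integrable01 f -> continuous (primitive f).
Proof.
move=> fi.
have fT := integrable01_restrict fi measurableT.
have key e : 0 < e -> exists2 d, 0 < d & forall x y, x <= y -> y - x < d ->
    `|primitive f y - primitive f x| < e.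
  move=> e0; have [d [d0 H]] := integral_normr_continuous fT e0.
  exists d => // x y xy yxd; rewrite primitiveB//.
  rewrite (le_lt_trans (le_normr_Rintegral _ _))//; first exact: integrable01_restrict.
  apply: H => //.
  have : (mu `]x, y] < d%:E)%E; last by [].
  rewrite lebesgue_measure_itv/=; case: ifPn => _; last by rewrite lte_fin.
  by rewrite -EFinB lte_fin.
move=> x; apply/cvgrPdist_lt => e e0.
have [d d0 H] := key e e0.
near=> y.
have xy : `|x - y| < d by near: y; apply: cvgr_dist_lt => //; exact: cvg_id.
have [le|/ltW le] := leP x y.
  by rewrite distrC H//; move: xy; rewrite distrC ger0_norm ?subr_ge0.
by rewrite H//; move: xy; rewrite ger0_norm ?subr_ge0.
Unshelve. all: by end_near. Qed.

Lemma ae_eq_primitive f g : integrable01 f -> integrable01 g ->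
  {ae mu, forall x, I01 x -> f x = g x} -> primitive f = primitive g.
Proof.
move=> fi gi fg; apply/funext => x; congr fine; apply: ae_eq_integral => //.
- by have /integrableP[] := integrable01_restrict fi (measurable_itv `]-oo, x]).
- by have /integrableP[] := integrable01_restrict gi (measurable_itv `]-oo, x]).
- apply: lebesgue_aeS fg => y fgy _ /=; congr EFin.
  by rewrite !patchE; case: ifPn => //; rewrite inE => /fgy.
Qed.

Lemma is_derive_primitive f (x : R) : integrable01 f -> {for x, continuous f} ->
  0 < x < 1 -> is_derive x 1 (primitive f) (f x).
Proof.
move=> fi cf x01.
have cr : {for x, continuous (f \_ I01)}.
  rewrite /prop_for /continuous_at patchE mem_set; last by rewrite /I01/= in_itv.
  apply: cvg_trans cf; apply: near_eq_cvg; near=> y.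
  rewrite patchE mem_set//= /I01/= in_itv/=; apply/andP; split; near: y.
    by apply: lt_nbhsr; case/andP: x01.
  by apply: lt_nbhsl; case/andP: x01.
have x2 : x < x + 1 by rewrite ltrDl.
have [D1 D2] := @continuous_FTC1 R (f \_ I01) -oo%O x (x + 1) x2
  (integrable01_restrict fi (measurable_itv _)) (ltNyr _) cr.
apply: DeriveDef; first exact: D1.
by rewrite -derive1E D2 patchE mem_set// /I01/= in_itv.
Unshelve. all: by end_near. Qed.

Lemma ae_is_derive_primitive f : integrable01 f ->
  {ae mu, forall x, I01 x -> is_derive x (1 : R) (primitive f) (f x)}.
Proof.
move=> fi.
have := @FTC1Ny R (f \_ I01) (fun y => integrable01_restrict fi (measurable_itv _))
  (integrable_locally_restrict measurable_I01 fi).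
apply: lebesgue_aeS => x /= [D1 D2] Ix; apply: DeriveDef; first exact: D1.
by rewrite -derive1E D2 patchE mem_set.
Qed.

Lemma test_function_continuous phi : test_function phi -> continuous phi.
Proof.
move=> [dphi _ _] x; apply/differentiable_continuous/derivable1_diffP.
exact: dphi.
Qed.

Lemma test_function_ends phi : test_function phi -> phi 0 = 0 /\ phi 1 = 0.
Proof.
move=> [_ _ [a [b [a0 b1 H]]]].
by split; apply: H; rewrite in_itv/=; apply/negP; lra.
Qed.

Lemma test_function_FTC phi (x y : R) : test_function phi -> x <= y ->
  (\int[mu]_(t in `[x, y]) (derive1 phi t)%:E = (phi y - phi x)%:E)%E.
Proof.
move=> tphi; rewrite le_eqVlt => /predU1P[->|xy].
  by rewrite set_itv1 integral_set1 subrr.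
have [dphi cphi _] := tphi; have c := test_function_continuous tphi.
have c1 : {within `[x, y], continuous (derive1 phi)} by exact: continuous_subspaceT.
have c2 : derivable_oo_LRcontinuous phi x y.
  split; first by move=> z _; exact: dphi.
    exact: cvg_at_right_filter (c x).
  exact: cvg_at_left_filter (c y).
have c3 : {in `]x, y[, derive1 phi =1 derive1 phi} by [].
exact: continuous_FTC2 xy c1 c2 c3.
Qed.

(** Fubini on the half-plane x <= y: integrating [f x * derive1 phi y] first in y gives
    [- (f x * phi x)] because phi 1 = 0, and first in x gives [primitive f y * derive1 phi y]. The
    primitive is never differentiated. *)
Lemma primitive_test_function f phi : integrable01 f -> test_function phi ->
  \int[mu]_(x in I01) (f x * phi x) =
  - \int[mu]_(x in I01) (primitive f x * derive1 phi x).
Proof.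
move=> fi tphi; have [dphi cphi _] := tphi.
have [phi0 phi1] := test_function_ends tphi.
pose f0 := f \_ I01; pose p0 := derive1 phi \_ I01.
pose T := measurableTypeR R.
have mf0 : measurable_fun (setT : set T) (f0 : T -> R).
  by have /integrableP[/measurable_EFinP H _] := integrable01_restrict fi measurableT.
have p0i : integrable01 (derive1 phi) by exact/L4_integrable/continuous_L4.
have mp0 : measurable_fun (setT : set T) (p0 : T -> R).
  by have /integrableP[/measurable_EFinP H _] := integrable01_restrict p0i measurableT.
pose K (z : T * T) : \bar R := ((if z.1 <= z.2 :> R then f0 z.1 * p0 z.2 else 0) : R)%:E.
have mK : measurable_fun setT K.
  apply/measurable_EFinP; apply: measurable_fun_ifT.
  - by apply: measurable_fun_ler; [exact: measurable_fst|exact: measurable_snd].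
  - apply: measurable_funM.
      by apply: (measurableT_comp mf0); exact: measurable_fst.
    by apply: (measurableT_comp mp0); exact: measurable_snd.
  - exact: measurable_cst.
pose P := (\int[mu]_y `|(p0 y)%:E|)%E.
have Pfin : (P < +oo)%E.
  by have /integrableP[] := integrable01_restrict p0i measurableT.
have P0 : (0 <= P)%E by exact: integral_ge0.
have iK : (mu \x mu)%E.-integrable setT K.
  apply/(integrable12ltyP _ _ mK).
  apply: (@le_lt_trans _ _ (\int[mu]_x (`|(f0 x)%:E| * P))%E).
    apply: ge0_le_integral => //.
    - by move=> x _; apply: integral_ge0.
    - apply: (@measurable_fun_fubini_tonelli_F _ _ _ _ _ _ (abse \o K)).
        exact: measurableT_comp.
      by move=> z; exact: abse_ge0.
    - apply: emeasurable_funM; last exact: measurable_cst.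
      by apply: measurableT_comp => //; exact/measurable_EFinP.
    - move=> x _; rewrite -ge0_integralZl//; last first.
        by apply: measurableT_comp => //; exact/measurable_EFinP.
      apply: ge0_le_integral => //.
      - apply: (measurableT_comp (f := abse \o K)); first exact: measurableT_comp.
        exact: measurable_pair1.
      - apply: emeasurable_funM; first exact: measurable_cst.
        by apply: measurableT_comp => //; exact/measurable_EFinP.
      - move=> y _; rewrite /K/=; case: ifP => _; first by rewrite normrM.
        by rewrite normr0 mule_ge0.
  rewrite ge0_integralZr//; last first.
    by apply: measurableT_comp => //; exact/measurable_EFinP.
  apply: lte_mul_pinfty => //.
  - exact: integral_ge0.
  - rewrite ge0_fin_numE; last exact: integral_ge0.
    by have /integrableP[] := integrable01_restrict fi measurableT.
have FE : (\int[mu]_x \int[mu]_y K (x, y) =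
    \int[mu]_x ((fun x => - (f x * phi x)) \_ I01 x)%:E)%E.
  apply: eq_integral => x _; rewrite patchE; case: ifPn => xI; last first.
    rewrite integral0_eq// => y _; rewrite /K/= /f0 patchE (negbTE xI) mul0r.
    by case: ifP.
  have /andP[x0 x1] : 0 < x < 1 by move: xI; rewrite inE /I01/= in_itv.
  transitivity (\int[mu]_(y in `[(x : R), 1%R[) (f x * derive1 phi y)%:E)%E.
    rewrite [RHS]integral_mkcond; apply: eq_integral => y _; rewrite /K/= /f0 /p0 !patchE xI.
    have [xy|xy] := leP x y; last first.
      by rewrite memNset//= in_itv/= leNgt xy.
    have [y1|y1] := ltP y 1.
      rewrite mem_set; last by rewrite /I01/= in_itv/= y1 (lt_le_trans x0).
      by rewrite mem_set//= in_itv/= xy y1.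
    have yI : y \notin I01.
      by rewrite notin_setE /I01/= in_itv/= => /andP[_]; rewrite ltNge y1.
    rewrite (negbTE yI) memNset; first exact: (congr1 EFin (mulr0 _)).
    by rewrite /= in_itv/= => /andP[_]; rewrite ltNge y1.
  under eq_integral do rewrite EFinM.
  have iab : mu.-integrable `[x, 1] (EFin \o derive1 phi).
    apply: continuous_compact_integrable; first exact: segment_compact.
    exact: continuous_subspaceT.
  rewrite integralZl//; last first.
    by apply: integrableS iab => //; apply: subset_itvScc; rewrite bnd_simp.
  rewrite integral_itv_bndo_bndc; last first.
    apply/measurable_EFinP/measurable_funTS; exact: continuous_measurable_fun.
  by rewrite (test_function_FTC tphi (ltW x1)) phi1 sub0r -EFinM mulrN.
have GE : (\int[mu]_y \int[mu]_x K (x, y) =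
    \int[mu]_y ((fun x => primitive f x * derive1 phi x) \_ I01 y)%:E)%E.
  apply: eq_integral => y _; rewrite [RHS]/= patchE; case: ifPn => yI; last first.
    rewrite integral0_eq// => x _; rewrite /K/= /p0 patchE (negbTE yI) mulr0.
    by case: ifP.
  transitivity (\int[mu]_(x in `]-oo, (y : R)]) (derive1 phi y * f0 x)%:E)%E.
    rewrite [RHS]integral_mkcond; apply: eq_integral => x _; rewrite /K/= /p0 !patchE yI.
    have [xy|xy] := leP x y; last first.
      by rewrite memNset//= in_itv/= leNgt xy.
    by rewrite mem_set//= ?in_itv//= mulrC.
  under eq_integral do rewrite EFinM.
  have i2 := integrable01_restrict fi (measurable_itv `]-oo, y]).
  rewrite integralZl//.
  rewrite mulrC EFinM; congr (_ * _)%E.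
  by rewrite /primitive /Rintegral fineK//; exact: integrable_fin_num.
have := congr1 fine (etrans (esym FE) (etrans (Fubini iK) GE)).
rewrite -[LHS]/(\int[mu]_x ((fun x => - (f x * phi x)) \_ I01) x).
rewrite -[RHS]/(\int[mu]_x ((fun x => primitive f x * derive1 phi x) \_ I01) x).
rewrite -!Rintegral_mkcond => <-.
have ip : integrable01 (fun x => f x * phi x).
  exact: integrable01_mul_continuous (test_function_continuous tphi).
under [X in _ = - X]eq_Rintegral do rewrite -mulN1r.
by rewrite RintegralZl// mulN1r opprK.
Qed.

Lemma integral_mul_indic f (a b : R) : integrable01 f -> a < b ->
  \int[mu]_(x in I01) (f x * (a < x < b)%R%:R) = primitive f b - primitive f a.
Proof.
move=> fi ab; rewrite primitiveB ?(ltW ab)// -Rintegral_itv_bndo_bndc; last first.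
  exact: integrable01_restrict.
rewrite Rintegral_mkcond [RHS]Rintegral_mkcond; apply: eq_Rintegral => x _.
rewrite !patchE; have [xI|xI] := boolP (x \in I01); last by case: ifP.
by rewrite mem_setE in_itv/=; case: ifP; rewrite ?mulr1 ?mulr0.
Qed.

(** This is min (max (t, 0), 1), written with absolute values so that continuity is immediate. *)
Let clamp (t : R) : R := (`|t| - `|t - 1| + 1) / 2.
(** Continuous, with values in [0, 1] and zero outside (0, s); as n grows it tends pointwise to the
    indicator of (0, s). *)
Let tent (s : R) (n : nat) (t : R) : R := clamp (n%:R * t) * clamp (n%:R * (s - t)).

Let clamp_le0 t : t <= 0 -> clamp t = 0.
Proof. by move=> t0; rewrite /clamp !ler0_norm; lra. Qed.

Let clamp_ge1 t : 1 <= t -> clamp t = 1.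
Proof. by move=> t0; rewrite /clamp !ger0_norm; lra. Qed.

Let clamp_itv t : 0 <= clamp t <= 1.
Proof.
have [t0|t0] := leP t 0; first by rewrite clamp_le0// lexx ler01.
have [t1|t1] := leP 1 t; first by rewrite clamp_ge1// lexx ler01.
by rewrite /clamp ger0_norm ?ler0_norm; lra.
Qed.

Let clamp_continuous : continuous clamp.
Proof.
have cn (g : R -> R) : continuous g -> continuous (fun x => `|g x|).
  by move=> cg x; apply: continuous_comp; [exact: cg|exact: norm_continuous].
move=> t; apply: cvgM; last exact: cvg_cst.
apply: cvgD; last exact: cvg_cst.
apply: cvgB; first exact: (cn id (fun=> cvg_id)).
by apply: (cn (fun x => x - 1)) => x; apply: cvgB; [exact: cvg_id|exact: cvg_cst].
Qed.

Let comp_continuous (g1 g2 : R -> R) : continuous g1 -> continuous g2 ->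
  continuous (fun x => g1 (g2 x)).
Proof.
by move=> c1 c2 x; apply: continuous_comp; [exact: c2|exact: c1].
Qed.

Let tent_continuous s n : continuous (tent s n).
Proof.
move=> t; apply: cvgM.
  apply: (comp_continuous clamp_continuous (g2 := fun x => n%:R * x)) => x.
  by apply: cvgM; [exact: cvg_cst|exact: cvg_id].
apply: (comp_continuous clamp_continuous (g2 := fun x => n%:R * (s - x))) => x.
apply: cvgM; first exact: cvg_cst.
by apply: cvgB; [exact: cvg_cst|exact: cvg_id].
Qed.

Let tent_shift_continuous s n c : continuous (fun x => tent s n (x - c)).
Proof.
apply: (comp_continuous (@tent_continuous s n) (g2 := fun x => x - c)) => x.
by apply: cvgB; [exact: cvg_id|exact: cvg_cst].
Qed.

Let tent_itv s n t : 0 <= tent s n t <= 1.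
Proof.
have /andP[a0 a1] := clamp_itv (n%:R * t).
have /andP[b0 b1] := clamp_itv (n%:R * (s - t)).
by rewrite /tent mulr_ge0//= mulr_ile1.
Qed.

Let tent_out s n t : ~~ (0 < t < s) -> tent s n t = 0.
Proof.
rewrite negb_and -!leNgt /tent => /orP[t0|ts].
  by rewrite clamp_le0 ?mul0r// mulr_ge0_le0.
by rewrite [X in _ * X]clamp_le0 ?mulr0// mulr_ge0_le0// subr_le0.
Qed.

Let tent_in s t : 0 < t < s -> \forall n \near \oo, tent s n t = 1.
Proof.
move=> /andP[t0 ts]; have st0 : 0 < s - t by rewrite subr_gt0.
near=> n.
have n1 : t^-1 <= n%:R by near: n; exact: nbhs_infty_ger.
have n2 : (s - t)^-1 <= n%:R by near: n; exact: nbhs_infty_ger.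
rewrite /tent !clamp_ge1 ?mulr1//.
  by rewrite -ler_pdivrMr// div1r.
by rewrite -ler_pdivrMr// div1r.
Unshelve. all: by end_near. Qed.

(** The difference of two translated tents has mean zero and lives in [a, b + s], hence it is the
    derivative of a test function. As the tents tend to indicators, orthogonality becomes equality
    of the integrals of f over (a, a + s) and (b, b + s). *)
Lemma orthogonal_increments f (a b s : R) : integrable01 f ->
  (forall phi, test_function phi -> \int[mu]_(x in I01) (f x * derive1 phi x) = 0) ->
  0 < a -> a <= b -> 0 < s -> b + s < 1 ->
  primitive f (a + s) - primitive f a = primitive f (b + s) - primitive f b.
Proof.
move=> fi forth a0 ab s0 bs.
pose h n x := tent s n (x - a) - tent s n (x - b).
have int0 n : \int[mu]_(x in I01) (f x * h n x) = 0.
  (* [r] is constant to the left of 0 and to the right of [s], so [r (x - a) - r (x - b)] vanishes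
     outside [a, b + s]. *)
  have [r rE] := continuous_antiderivative (@tent_continuous s n).
  have rc (t : R) : {for t, continuous r} by exact: is_derive1_continuous (rE t).
  have r0 t : t <= 0 -> r t = r 0.
    move=> t0; apply: derive_eq0_cst => // x /andP[tx x0].
    have <- : tent s n x = 0 by apply: tent_out; rewrite negb_and -leNgt ltW.
    exact: rE.
  have rs t : s <= t -> r t = r s.
    move=> st; apply/esym; apply: derive_eq0_cst => // x /andP[tx x0].
    have <- : tent s n x = 0 by apply: tent_out; rewrite negb_and -!leNgt (ltW tx) orbT.
    exact: rE.
  pose phi x := r (x - a) - r (x - b).
  have dshift (c x : R) : is_derive x 1 (fun x : R => x - c) 1.
    by rewrite -[X in is_derive _ _ _ X]subr0; exact: is_deriveB.
  have dphi (x : R) : is_derive x 1 phi (h n x).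
    apply: is_deriveB; rewrite -[tent _ _ _]mulr1; exact: is_derive1_comp.
  have dE : derive1 phi = h n.
    by apply/funext => x; rewrite derive1E; exact: derive_val.
  have ch : continuous (h n).
    by move=> x; apply: cvgB; exact: tent_shift_continuous.
  rewrite -dE; apply: forth; split.
  - by move=> x; exact: ex_derive.
  - by rewrite dE.
  - exists a, (b + s); split => // x; rewrite in_itv/= negb_and -!ltNge /phi => /orP[xa|xb].
      by rewrite !r0 ?subrr//; lra.
    by rewrite !rs ?subrr//; lra.
pose g x : R := (a < x < a + s)%R%:R - (b < x < b + s)%R%:R.
have hg x : h n x @[n --> \oo] --> g x.
  have key c : tent s n (x - c) @[n --> \oo] --> ((c < x < c + s)%R%:R : R).
    have [xc|xc] := boolP (c < x < c + s).
      apply: cvg_near_cst; apply: tent_in.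
      by rewrite subr_gt0 ltrBlDl.
    rewrite (_ : (fun n => tent s n (x - c)) = cst 0); first exact: cvg_cst.
    by apply/funext => n; apply: tent_out; apply: contra xc; lra.
  by apply: cvgB; exact: key.
have h1 n x : `|h n x| <= 1.
  by have := tent_itv s n (x - a); have := tent_itv s n (x - b); rewrite ler_norml /h; lra.
have p1 n : measurable_fun (I01 : set (measurableTypeR R)) (fun x => (f x * h n x)%:E).
  apply/measurable_EFinP; apply: measurable_funM; first exact: measurable_integrable01.
  apply: continuous_measurable_I01 => x; apply: cvgB; exact: tent_shift_continuous.
have mind (c d : R) :
    measurable_fun (I01 : set (measurableTypeR R)) (fun x => ((c < x < d)%R%:R : R)).
  rewrite (_ : (fun _ => _) = \1_(`]c, d[%classic : set (measurableTypeR R))); last first.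
    by apply/funext => x; rewrite indicE mem_setE in_itv.
  exact: measurable_indic.
have p2 : measurable_fun (I01 : set (measurableTypeR R)) (fun x => (f x * g x)%:E).
  apply/measurable_EFinP; apply: measurable_funM; first exact: measurable_integrable01.
  by apply: measurable_funB; exact: mind.
have p3 : {ae mu, forall x, I01 x -> (f x * h n x)%:E @[n --> \oo] --> (f x * g x)%:E}.
  apply: aeW => x _; apply: cvg_EFin; first exact: nearW.
  by apply: cvgM; [exact: cvg_cst|exact: hg].
have p4 : {ae mu, forall x n, I01 x -> (`|(f x * h n x)%:E| <= `|f x|%:E)%E}.
  by apply: aeW => x n _; rewrite /= lee_fin normrM ler_piMr.
have [_ _ lim0] := dominated_convergence measurable_I01 p1 p2 p3 (integrable_norm fi) p4.
have intg : (\int[mu]_(x in I01) (f x * g x)%:E = 0)%E.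
  have E n : (\int[mu]_(x in I01) (f x * h n x)%:E = 0)%E.
    rewrite -[LHS]fineK; last first.
      apply: integrable_fin_num => //; apply: (@le_integrable01 _ _ (fun x => `|f x|)).
      - by move/measurable_EFinP: (p1 n).
      - by move=> x _; rewrite normrM ler_piMr.
      - exact: integrable_norm.
    by have := int0 n; rewrite /Rintegral => ->.
  have c0 : (\int[mu]_(x in I01) (f x * h n x)%:E)%E @[n --> \oo] --> 0%E.
    by under eq_fun do rewrite E; exact: cvg_cst.
  exact: (cvg_unique (@ereal_hausdorff R) lim0 c0).
have i c d : integrable01 (fun x => f x * (c < x < d)%R%:R).
  apply: (@le_integrable01 _ _ (fun x => `|f x|)).
  - by apply: measurable_funM; [exact: measurable_integrable01|exact: mind].
  - by move=> x _; rewrite normrM ler_piMr//; case: (_ < _ < _); rewrite ?normr1 ?normr0.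
  - exact: integrable_norm.
have aas : a < a + s by rewrite ltrDl.
have bbs : b < b + s by rewrite ltrDl.
apply/eqP; rewrite -subr_eq0 -(integral_mul_indic fi aas) -(integral_mul_indic fi bbs).
rewrite -(RintegralB measurable_I01 (i _ _) (i _ _)); apply/eqP.
transitivity (\int[mu]_(x in I01) (f x * g x)); last by rewrite /Rintegral intg.
by apply: eq_Rintegral => x _; rewrite /g mulrBr.
Qed.

Lemma ae_I01_nonempty (P : R -> Prop) : {ae mu, forall x, I01 x -> P x} ->
  exists2 x, I01 x & P x.
Proof.
move=> aeP; apply: contrapT => nP.
have : {ae mu, forall x, ~ I01 x}.
  by apply: lebesgue_aeS aeP => x Px Ix; apply: nP; exists x => //; exact: Px.
move=> [A [mA A0 sub]].
have : (mu I01 <= mu A)%E.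
  apply: le_measure; rewrite ?inE//.
  by move=> x Ix; apply: sub => /=; exact.
by rewrite A0 lebesgue_measure_I01 lee_fin ler10.
Qed.

Lemma is_derive_at_right f (x l : R) : is_derive x 1 f l ->
  h^-1 * (f (x + h) - f x) @[h --> 0^'+] --> l.
Proof.
move=> [d v]; apply: cvg_dnbhs_at_right.
have : h^-1 *: (f (h *: 1 + x) - f x) @[h --> 0^'] --> l by rewrite -v; exact: d.
by under eq_fun do rewrite {1}/GRing.scale/= [X in X + x]mulr1 [X in f X]addrC.
Qed.

(** At two points where the primitive has derivative f, equal increments give equal difference
    quotients, so f takes the same value at both; by Lebesgue differentiation almost every point is
    of this kind. *)
Lemma du_bois_reymond f : integrable01 f ->
  (forall phi, test_function phi -> \int[mu]_(x in I01) (f x * derive1 phi x) = 0) ->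
  exists C, {ae mu, forall x, I01 x -> f x = C}.
Proof.
move=> fi forth; have aeD := ae_is_derive_primitive fi.
have [a Ia Da] := ae_I01_nonempty aeD.
exists (f a); apply: lebesgue_aeS aeD => b Db Ib; move/(_ Ib) : Db.
have key (x y : R) : I01 x -> I01 y -> x <= y ->
    is_derive x 1 (primitive f) (f x) -> is_derive y 1 (primitive f) (f y) -> f y = f x.
  rewrite /I01/= !in_itv/= => /andP[x0 x1] /andP[y0 y1] xy Dx Dy.
  apply: (cvg_unique _ (is_derive_at_right Dy)) => //.
  apply: cvg_trans (is_derive_at_right Dx); apply: near_eq_cvg; near=> s.
  rewrite (@orthogonal_increments f x y s)// -ltrBrDl.
  by near: s; apply: nbhs_right_lt; rewrite subr_gt0.
have [ab|/ltW ba] := leP a b; first exact: key.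
by move=> Db; apply/esym; exact: key.
Unshelve. all: by end_near. Qed.

(** Integration by parts makes [f - primitive g] orthogonal to every [derive1 phi]. *)
Lemma weak_derivative_primitive f g : integrable01 f -> integrable01 g ->
  (forall phi, test_function phi -> \int[mu]_(x in I01) (f x * derive1 phi x) =
    - \int[mu]_(x in I01) (g x * phi x)) ->
  exists C, {ae mu, forall x, I01 x -> f x = C + primitive g x}.
Proof.
move=> fi gi fg.
have pgi : integrable01 (primitive g).
  exact/L4_integrable/continuous_L4/primitive_continuous.
have [|C aeC] := du_bois_reymond (f := fun x => f x - primitive g x) (integrable01B fi pgi).
  move=> phi tphi; have [_ cphi _] := tphi.
  under eq_Rintegral do rewrite mulrBl.
  rewrite (RintegralB measurable_I01 (integrable01_mul_continuous fi cphi)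
    (integrable01_mul_continuous pgi cphi)) fg// primitive_test_function//.
  by rewrite opprK subrr.
exists C; apply: lebesgue_aeS aeC => x H Ix.
by rewrite -(H Ix) subrK.
Qed.

End Primitive.

(** * From weak to classical solutions *)

Section Regularity.
Context {R : realType}.
Local Notation mu := (@lebesgue_measure R).
Local Notation integrable01 f := (mu.-integrable I01 (EFin \o f)).
Implicit Types f g u v du dv phi : R -> R.
Hint Resolve measurable_I01 : core.

Lemma primitive_sub f g (x : R) : integrable01 f -> integrable01 g ->
  primitive f x - primitive g x = primitive (fun t => f t - g t) x.
Proof.
move=> fi gi; rewrite /primitive -RintegralB//; try exact: integrable01_restrict.
apply: eq_Rintegral => t _; rewrite !patchE; case: ifP => // _; exact: subrr.
Qed.

Lemma le_normr_primitive f (x : R) : integrable01 f ->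
  `|primitive f x| <= \int[mu]_(t in I01) `|f t|.
Proof.
move=> fi; rewrite primitiveE.
have mD : measurable (`]-oo, x] `&` I01 : set (measurableTypeR R)).
  exact: measurableI.
have iD : mu.-integrable (`]-oo, x] `&` I01) (EFin \o f).
  by apply: integrableS fi => // t [].
apply: le_trans (le_normr_Rintegral mD iD) _.
rewrite Rintegral_mkcondl; apply: le_Rintegral => //; last 2 first.
- exact: integrable_norm.
- move=> t _; rewrite patchE; case: ifP => _; first exact: lexx.
  exact: normr_ge0.
rewrite -restrict_EFin; apply/integrable_restrict => //.
by rewrite setIC; apply: integrableS (integrable_norm fi).
Qed.

Lemma ae_eq0_of_integral_norm f : integrable01 f ->
  \int[mu]_(x in I01) `|f x| <= 0 -> {ae mu, forall x, I01 x -> f x = 0}.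
Proof.
move=> fi f0.
have mf : measurable_fun (I01 : set (measurableTypeR R)) (EFin \o f).
  by case/integrableP: fi.
have E : (\int[mu]_(x in I01) `|(EFin \o f) x| = 0)%E.
  have fin : (\int[mu]_(x in I01) (`|f x|)%:E)%E \is a fin_num.
    exact: integrable_fin_num (integrable_norm fi).
  rewrite -[LHS](fineK fin); congr EFin; apply/eqP; rewrite eq_le f0/=.
  exact: Rintegral_ge0.
have := (ae_eq_integral_abs mu measurable_I01 mf).1 E.
apply: lebesgue_aeS => x H Ix; apply: EFin_inj; exact: H.
Qed.

Lemma ae_eq_integral01 f g : measurable_fun I01 f -> measurable_fun I01 g ->
  {ae mu, forall x, I01 x -> f x = g x} ->
  \int[mu]_(x in I01) f x = \int[mu]_(x in I01) g x.
Proof.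
move=> mf mg fg; congr fine; apply: ae_eq_integral => //.
- by apply/measurable_EFinP; exact: mf.
- by apply/measurable_EFinP; exact: mg.
- by apply: lebesgue_aeS fg => x H Ix; rewrite /= H.
Qed.

Lemma primitive_derive f df (x : R) : continuous f -> continuous df ->
  (forall t : R, 0 < t < 1 -> is_derive t 1 f (df t)) -> 0 <= x <= 1 ->
  primitive df x = f x - f 0.
Proof.
move=> cf cdf fdf /andP[x0 x1].
have dfi : integrable01 df by exact/L4_integrable/continuous_L4.
have : primitive df 0 - f 0 = primitive df x - f x.
  apply: (@derive_eq0_cst _ (fun x => primitive df x - f x)) => // t t0x.
    have t01 : 0 < t < 1 by case/andP: t0x => -> /lt_le_trans->.
    rewrite -(subrr (df t)); apply: is_deriveB; last exact: fdf.
    exact: (is_derive_primitive dfi (cdf t) t01).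
  by apply: cvgB; [exact: primitive_continuous|exact: cf].
by rewrite (primitive_le0 _ (lexx 0)) sub0r => /eqP; rewrite eq_sym subr_eq addrC => /eqP.
Qed.

Lemma test_function_primitive phi (x : R) : test_function phi -> 0 <= x <= 1 ->
  primitive (derive1 phi) x = phi x.
Proof.
move=> tphi x01; have [dphi cphi _] := tphi.
have [phi0 _] := test_function_ends tphi.
have E (t : R) : 0 < t < 1 -> is_derive t 1 phi (derive1 phi t).
  by move=> _; apply: DeriveDef; [exact: dphi|rewrite -derive1E].
by rewrite (primitive_derive (test_function_continuous tphi) cphi E x01) phi0 subr0.
Qed.

Lemma test_function_W014 phi : test_function phi -> W014 phi (derive1 phi).
Proof.
move=> tphi; have [dphi cphi _] := tphi.
have L1 : L4 phi by exact/continuous_L4/test_function_continuous.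
have L2 : L4 (derive1 phi) by exact: continuous_L4.
have z f : L4norm (fun x => f x - f x) @[_ --> \oo] --> 0%E.
  apply: (@bounded_pointwise_L4norm_cvg0 _ (fun _ x => f x - f x) 0).
  - by move=> _; under eq_fun do rewrite subrr; exact: measurable_cst.
  - by move=> n x _; rewrite subrr normr0.
  - by apply: aeW => x _; rewrite subrr; exact: cvg_cst.
split; last by exists (fun=> phi); split => //; exact: z.
split => // chi tchi.
rewrite (primitive_test_function (L4_integrable L2) tchi) opprK.
apply: eq_Rintegral => x; rewrite inE /I01/= in_itv/= => /andP[x0 x1].
by rewrite test_function_primitive// !ltW.
Qed.

(** A test function is the primitive of its derivative, so it differs from [primitive du] on [0, 1]
    by at most the L1-norm of [derive1 phi - du]. In the limit this identifies u and carries the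
    boundary value at 1 along. *)
Lemma W014_primitive u du : W014 u du ->
  {ae mu, forall x, I01 x -> u x = primitive du x} /\ primitive du 1 = 0.
Proof.
move=> [[uL duL _] [phi [tphi phiu dphiu]]].
have ui := L4_integrable uL; have dui := L4_integrable duL.
have pdu : integrable01 (primitive du).
  exact/L4_integrable/continuous_L4/primitive_continuous.
have cphi n : continuous (phi n) by exact: test_function_continuous.
have cdphi n : continuous (derive1 (phi n)) by have [] := tphi n.
have key e : 0 < e -> exists n, \int[mu]_(x in I01) `|phi n x - u x| <= e /\
    forall x, 0 <= x <= 1 -> `|phi n x - primitive du x| <= e.
  move=> e0.
  have m1 n : measurable_fun I01 (fun x => phi n x - u x).
    apply: measurable_funB; first exact: continuous_measurable_I01.
    exact: measurable_integrable01.
  have m2 n : measurable_fun I01 (fun x => derive1 (phi n) x - du x).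
    apply: measurable_funB; first exact: continuous_measurable_I01.
    exact: measurable_integrable01.
  have N1 := L4norm_cvg0_L1 m1 phiu e0.
  have N2 := L4norm_cvg0_L1 m2 dphiu e0.
  have [N _ H] : \forall n \near \oo, \int[mu]_(x in I01) `|phi n x - u x| <= e /\
      \int[mu]_(x in I01) `|derive1 (phi n) x - du x| <= e.
    by apply: filterS2 N1 N2 => n [_ H1] [_ H2].
  have [H1 H2] := H N (leqnn N).
  exists N; split => // x x01.
  have dpi : integrable01 (derive1 (phi N)) by exact/L4_integrable/continuous_L4.
  rewrite -(test_function_primitive (tphi N) x01) primitive_sub//.
  by apply: le_trans (le_normr_primitive _ _) H2; exact: integrable01B.
split; last first.
  apply/eqP; rewrite -normr_le0; apply/ler_addgt0Pl => e e0; rewrite addr0.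
  have [n [_ /(_ 1)]] := key e e0.
  have [_ ->] := test_function_ends (tphi n).
  by rewrite sub0r normrN ler01 lexx => /(_ isT).
have H : {ae mu, forall x, I01 x -> u x - primitive du x = 0}.
  apply: ae_eq0_of_integral_norm; first exact: integrable01B.
  apply/ler_addgt0Pl => e e0; rewrite addr0.
  have e2 : 0 < e / 2 by rewrite divr_gt0.
  have [n [H1 H2]] := key _ e2.
  have i1 : integrable01 (fun x => phi n x - u x).
    by apply: integrable01B => //; exact/L4_integrable/continuous_L4.
  have ic : integrable01 (fun=> e / 2).
    apply: measurable_bounded_integrable => //; first exact: I01_ltoo.
    exact: bounded_cst.
  apply: (@le_trans _ _ (\int[mu]_(x in I01) (`|phi n x - u x| + e / 2))).
    apply: le_Rintegral => //.
    - by apply: integrable_norm; exact: integrable01B.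
    - by apply: integrable01D => //; exact: integrable_norm.
    - move=> x; rewrite /I01/= in_itv/= => /andP[x0 x1].
      have -> : u x - primitive du x = - (phi n x - u x) + (phi n x - primitive du x) by ring.
      rewrite (le_trans (ler_normD _ _))// normrN lerD2l H2//.
      by rewrite !ltW.
  rewrite RintegralD//; last exact: integrable_norm.
  have m1 : fine (mu (@I01 R)) = 1 by rewrite lebesgue_measure_I01.
  rewrite Rintegral_cst// m1 mulr1.
  by rewrite [leRHS]splitr lerD2r.
by apply: lebesgue_aeS H => x H Ix; apply/eqP; rewrite -subr_eq0 H.
Qed.

Lemma cubic_root_exists (a y : R) : 0 <= a -> exists p, (a + p ^+ 2) * p = y.
Proof.
move=> a0; pose M := `|y| + 1; have M1 : 1 <= M by rewrite /M lerDr.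
have yM : `|y| <= M by rewrite /M lerDl.
have MM : M <= (a + M ^+ 2) * M.
  rewrite ler_peMl ?(le_trans ler01)//.
  by rewrite (le_trans (_ : 1 <= M ^+ 2)) ?exprn_ege1// lerDr.
have [|||p _ pE] := @IVT R (fun p => (a + p ^+ 2) * p) (- M) M y.
- lra.
- apply: continuous_subspaceT => p; apply: cvgM; last exact: cvg_id.
  apply: cvgD; first exact: cvg_cst.
  by apply: cvg_exprn; exact: cvg_id.
- rewrite sqrrN mulrN; move: yM; rewrite ler_norml => /andP[y1 y2].
  by rewrite ge_min le_max; apply/andP; split; apply/orP; [left|right]; lra.
by exists p.
Qed.

(** The difference factors as p - r times a + p^2 + p r + r^2, and the second factor is at least (p
    - r)^2 / 4. The bound is uniform in a >= 0, so it gives uniqueness and continuity of the root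
    also at a = 0, where the cubic has a critical point. *)
Lemma cubic_root_dist (a p r : R) : 0 <= a ->
  `|p - r| ^+ 3 <= 4 * `|(a + p ^+ 2) * p - (a + r ^+ 2) * r|.
Proof.
move=> a0.
have -> : (a + p ^+ 2) * p - (a + r ^+ 2) * r =
    (p - r) * (a + ((p - r) ^+ 2 / 4 + 3 / 4 * (p + r) ^+ 2)) by field.
rewrite normrM mulrCA exprS ler_wpM2l// real_normK ?num_real//.
have := sqr_ge0 (p - r); have := sqr_ge0 (p + r) => H1 H2.
by rewrite ger0_norm; lra.
Qed.

Lemma cubic_root_continuous (a y D : R -> R) : continuous a -> continuous y ->
  (forall x, 0 <= a x) -> (forall x, (a x + D x ^+ 2) * D x = y x) -> continuous D.
Proof.
move=> ca cy a0 DE x.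
have c0 : (y t - y x - (a t - a x) * D x) @[t --> x] --> (0 : R).
  have -> : 0 = y x - y x - (a x - a x) * D x by rewrite !subrr mul0r subrr.
  apply: cvgB; first by apply: cvgB; [exact: cy|exact: cvg_cst].
  apply: cvgM; last exact: cvg_cst.
  by apply: cvgB; [exact: ca|exact: cvg_cst].
apply/cvgrPdist_le => e e0.
have e3 : 0 < e ^+ 3 / 4 by rewrite divr_gt0 ?exprn_gt0.
move/cvgrPdist_le: c0 => /(_ _ e3); apply: filterS => t; rewrite sub0r normrN => H.
rewrite -(@ler_pXn2r _ 3)// ?nnegrE ?(ltW e0)//.
rewrite distrC (le_trans (cubic_root_dist (D t) (D x) (a0 t)))//.
rewrite mulrC -ler_pdivlMr// DE.
have -> : (a t + D x ^+ 2) * D x = y x + (a t - a x) * D x by rewrite -(DE x); ring.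
by rewrite opprD addrA.
Qed.

Lemma ae_exprn_eq0 f : {ae mu, forall x, I01 x -> f x ^+ 4 = 0} ->
  {ae mu, forall x, I01 x -> f x = 0}.
Proof.
by apply: lebesgue_aeS => x H Ix; have /eqP := H Ix; rewrite expf_eq0/= => /eqP.
Qed.

Lemma integral_pow4_gt0 u : L4 u -> ~ trivial u -> 0 < \int[mu]_(x in I01) (u x ^+ 4).
Proof.
move=> uL ntriv; rewrite ltNge; apply/negP => A0; apply: ntriv.
apply/ae_exprn_eq0/ae_eq0_of_integral_norm; first by have [] := (L4P u).1 uL.
rewrite (le_trans _ A0)// le_eqVlt; apply/orP; left; apply/eqP.
by apply: eq_Rintegral => x _; rewrite ger0_norm// exprn_even_ge0.
Qed.

(** The identity reads k^4 A + 2 k^2 C + B = lambda A, where A, B, C are the integrals of u^4, u'^4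
    and u^2 u'^2. If lambda <= k^4, then B <= 0, so u' = 0 almost everywhere, and u, being almost
    everywhere the primitive of u', vanishes. *)
Lemma eigenvalue_gt (lambda k : R) u du : W014 u du -> ~ trivial u ->
  k ^+ 2 * \int[mu]_(x in I01) ((k ^+ 2 * u x ^+ 2 + du x ^+ 2) * u x * u x)
  + \int[mu]_(x in I01) ((k ^+ 2 * u x ^+ 2 + du x ^+ 2) * du x * du x)
  = lambda * \int[mu]_(x in I01) (u x ^+ 3 * u x) -> k ^+ 4 < lambda.
Proof.
move=> W ntriv H; have [[uL duL _] _] := W.
have A0 := integral_pow4_gt0 uL ntriv.
have [_ i4] := (L4P _).1 uL; have [_ id4] := (L4P _).1 duL.
have i2 := L4_integrable_mul4 uL uL duL duL.
have B0 : 0 <= \int[mu]_(x in I01) (du x ^+ 4).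
  by apply: Rintegral_ge0 => x _; rewrite exprn_even_ge0.
have C0 : 0 <= \int[mu]_(x in I01) (u x * u x * du x * du x).
  apply: Rintegral_ge0 => x _.
  have -> : u x * u x * du x * du x = (u x * du x) ^+ 2 by ring.
  exact: sqr_ge0.
move: H.
have -> : \int[mu]_(x in I01) (u x ^+ 3 * u x) = \int[mu]_(x in I01) (u x ^+ 4).
  by apply: eq_Rintegral => x _; ring.
have -> : \int[mu]_(x in I01) ((k ^+ 2 * u x ^+ 2 + du x ^+ 2) * u x * u x) =
  k ^+ 2 * \int[mu]_(x in I01) (u x ^+ 4) + \int[mu]_(x in I01) (u x * u x * du x * du x).
  rewrite -(RintegralZl _ measurable_I01 i4) -(RintegralD measurable_I01 (integrable01Z _ i4) i2).
  by apply: eq_Rintegral => x _; ring.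
have -> : \int[mu]_(x in I01) ((k ^+ 2 * u x ^+ 2 + du x ^+ 2) * du x * du x) =
  k ^+ 2 * \int[mu]_(x in I01) (u x * u x * du x * du x) + \int[mu]_(x in I01) (du x ^+ 4).
  rewrite -(RintegralZl _ measurable_I01 i2) -(RintegralD measurable_I01 (integrable01Z _ i2) id4).
  by apply: eq_Rintegral => x _; ring.
set A := \int[mu]_(x in I01) (u x ^+ 4) in A0 *.
set B := \int[mu]_(x in I01) (du x ^+ 4) in B0 *.
set C := \int[mu]_(x in I01) (u x * u x * du x * du x) in C0 *.
move=> H; rewrite ltNge; apply/negP => lk; apply: ntriv.
have BB : B <= 0.
  have -> : B = - ((k ^+ 4 - lambda) * A) - 2 * (k ^+ 2 * C).
    by move: H; rewrite (_ : k ^+ 4 = k ^+ 2 * k ^+ 2); [lra|ring].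
  have := mulr_ge0 (sqr_ge0 k) C0.
  have : 0 <= (k ^+ 4 - lambda) * A by rewrite mulr_ge0 ?subr_ge0// ltW.
  lra.
have du0 : {ae mu, forall x, I01 x -> du x = 0}.
  apply/ae_exprn_eq0/ae_eq0_of_integral_norm => //.
  rewrite (le_trans _ BB)// le_eqVlt; apply/orP; left; apply/eqP.
  by apply: eq_Rintegral => x _; rewrite ger0_norm// exprn_even_ge0.
have dui := L4_integrable duL.
have p0 x : primitive du x = 0.
  apply/eqP; rewrite -normr_le0 (le_trans (le_normr_primitive _ dui))//.
  rewrite (@ae_eq_integral01 _ (fun=> 0)).
  - by rewrite Rintegral_cst// mul0r.
  - by apply: measurable_integrable01; exact: integrable_norm dui.
  - exact: measurable_cst.
  - by apply: lebesgue_aeS du0 => y Hy Iy; rewrite Hy// normr0.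
have [up _] := W014_primitive W.
by apply: lebesgue_aeS up => x Hx Ix; rewrite Hx.
Qed.

Lemma weak_solution_classical (lambda k : R) u :
  is_solution lambda k u -> ~ trivial u -> exists q,
  [/\ 0 < q, lambda = k ^+ 4 + 3 * q ^+ 2 &
      exists U D, classical_solution (k ^+ 2 / 3) q U D /\
        exists2 x, 0 < x < 1 & U x != 0].
Proof.
move=> [du W weq] ntriv; have [[uL duL _] _] := W.
have kl := eigenvalue_gt W ntriv (weq u du W).
pose q := Num.sqrt ((lambda - k ^+ 4) / 3).
have q0 : 0 < q by rewrite sqrtr_gt0 divr_gt0// subr_gt0.
have lE : lambda = k ^+ 4 + 3 * q ^+ 2.
  by rewrite sqr_sqrtr ?divr_ge0 ?subr_ge0 ?(ltW kl)//; field.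
exists q; split => //.
have L1 := @L4_cst1 R.
(* The weak equation says that the flux [psi] has weak derivative [g]. *)
pose psi x := (k ^+ 2 * u x ^+ 2 + du x ^+ 2) * du x.
pose A x := (k ^+ 2 * u x ^+ 2 + du x ^+ 2) * u x.
pose g x := k ^+ 2 * A x - lambda * u x ^+ 3.
have psii : integrable01 psi.
  apply: eq_integrable01 (integrable01D
    (integrable01Z (k ^+ 2) (L4_integrable_mul4 uL uL duL L1))
    (L4_integrable_mul4 duL duL duL L1)) => x _.
  by rewrite /psi; ring.
have Ai : integrable01 A.
  apply: eq_integrable01 (integrable01D
    (integrable01Z (k ^+ 2) (L4_integrable_mul4 uL uL uL L1))
    (L4_integrable_mul4 duL duL uL L1)) => x _.
  by rewrite /A; ring.
have u3i : integrable01 (fun x => u x ^+ 3).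
  apply: eq_integrable01 (L4_integrable_mul4 uL uL uL L1) => x _; ring.
have gi : integrable01 g by apply: integrable01B; exact: integrable01Z.
have weak phi : test_function phi -> \int[mu]_(x in I01) (psi x * derive1 phi x) =
    - \int[mu]_(x in I01) (g x * phi x).
  move=> tphi; have cphi := test_function_continuous tphi.
  have H := weq _ _ (test_function_W014 tphi).
  have Aphi := integrable01_mul_continuous Ai cphi.
  have u3phi := integrable01_mul_continuous u3i cphi.
  have -> : \int[mu]_(x in I01) (g x * phi x) =
      k ^+ 2 * \int[mu]_(x in I01) (A x * phi x) - lambda * \int[mu]_(x in I01) (u x ^+ 3 * phi x).
    rewrite -(RintegralZl _ measurable_I01 Aphi) -(RintegralZl _ measurable_I01 u3phi).
    rewrite -(RintegralB measurable_I01 (integrable01Z _ Aphi) (integrable01Z _ u3phi)).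
    by apply: eq_Rintegral => x _; rewrite /g; ring.
  by rewrite -H /psi /A; ring.
have [C psiE] := weak_derivative_primitive psii gi weak.
have [uE U1] := W014_primitive W.
have dui := L4_integrable duL.
pose U := primitive du.
pose Psi x := C + primitive g x.
have cU : continuous U by exact: primitive_continuous.
have cPsi : continuous Psi.
  by move=> x; apply: cvgD; [exact: cvg_cst|exact: primitive_continuous].
pose a x := k ^+ 2 * U x ^+ 2.
have a0 x : 0 <= a x by rewrite mulr_ge0 ?sqr_ge0.
(* A representative of u' defined everywhere: the root of the cubic whose right-hand side is [Psi],
   the continuous representative of the flux. *)
pose D x := sval (cid (cubic_root_exists (Psi x) (a0 x))).
have DE x : (a x + D x ^+ 2) * D x = Psi x by rewrite /D; case: cid.
have ca : continuous a.
  by move=> x; apply: cvgM; [exact: cvg_cst|exact: cvg_exprn (cU x)].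
have cD : continuous D by exact: cubic_root_continuous ca cPsi a0 DE.
have duD : {ae mu, forall x, I01 x -> du x = D x}.
  apply: (lebesgue_aeS2 _ uE psiE) => x Hu Hp Ix.
  have := cubic_root_dist (du x) (D x) (a0 x).
  rewrite DE /a /U -Hu// -/(psi x) Hp// /Psi subrr normr0 mulr0 => H.
  have : `|du x - D x| ^+ 3 == 0 by rewrite eq_le H exprn_ge0.
  by rewrite expf_eq0/= normr_eq0 subr_eq0 => /eqP.
have Di : integrable01 D by exact/L4_integrable/continuous_L4.
have UE : U = primitive D by exact: ae_eq_primitive.
(* The continuous representative of [g], with lambda expressed through q; with it the primitive of
   [g] is differentiable at every point of (0, 1). *)
pose gc x := - 3 * q ^+ 2 * U x ^+ 3 + 3 * (k ^+ 2 / 3) * U x * D x ^+ 2.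
have cgc : continuous gc.
  move=> x; apply: cvgD; apply: cvgM.
  - exact: cvg_cst.
  - exact: cvg_exprn (cU x).
  - by apply: cvgM; [exact: cvg_cst|exact: cU].
  - exact: cvg_exprn (cD x).
have gci : integrable01 gc by exact/L4_integrable/continuous_L4.
have ggc : primitive g = primitive gc.
  apply: ae_eq_primitive => //; apply: (lebesgue_aeS2 _ uE duD) => x Hu Hd Ix.
  by rewrite /g /A /gc lE Hu// Hd// /U; field.
exists U, D; split; last first.
  apply: contrapT => nU; apply: ntriv; apply: lebesgue_aeS uE => x Hx Ix.
  rewrite Hx//; apply/eqP/negPn/negP => Ux; apply: nU; exists x; last exact: Ux.
  by have := Ix; rewrite /I01/= in_itv.
split.
- exact: cU.
- exact: cD.
- by split; [exact: primitive_le0|exact: U1].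
- by move=> x x01; rewrite UE; exact: (is_derive_primitive Di (cD x) x01).
- move=> x x01.
  have -> : (fun x => (3 * (k ^+ 2 / 3) * U x ^+ 2 + D x ^+ 2) * D x) = Psi.
    by apply/funext => y; rewrite -DE /a; field.
  have dg := is_derive_primitive gci (cgc x) x01.
  rewrite /Psi ggc -[X in is_derive _ _ _ X]add0r.
  by apply: is_deriveD.
Qed.

End Regularity.

(** * A C^1 truncation near zero *)

Section Truncation.
Context {R : realType}.
Implicit Types e s t : R.

Definition pos_part s : R := (s + `|s|) / 2.

Lemma pos_part_ge s : s <= pos_part s.
Proof. by rewrite /pos_part; have := ler_norm s; lra. Qed.

Lemma pos_part_ge0 s : 0 <= pos_part s.
Proof. by rewrite /pos_part; have := lerNnormlW (lexx `|s|); lra. Qed.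

Lemma pos_part_id s : 0 <= s -> pos_part s = s.
Proof. by move=> s0; rewrite /pos_part ger0_norm//; field. Qed.

Lemma pos_part_eq0 s : s <= 0 -> pos_part s = 0.
Proof. by move=> s0; rewrite /pos_part ler0_norm// subrr mul0r. Qed.

Lemma pos_part_continuous : continuous pos_part.
Proof.
move=> s; apply: cvgM; last exact: cvg_cst.
by apply: cvgD; [exact: cvg_id|exact: norm_continuous].
Qed.

Lemma is_derive_sqr (f : R -> R) (x df : R) : is_derive x 1 f df ->
  is_derive x 1 (fun y => f y ^+ 2) (2 * f x * df).
Proof.
move=> H; apply: (is_derive_eq (is_deriveM H H)).
by rewrite /GRing.scale/=; ring.
Qed.

Lemma is_derive_sqr_pos_part s :
  is_derive s 1 (fun x => pos_part x ^+ 2) (2 * pos_part s).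
Proof.
have [s0|s0|->] := ltrgtP s 0.
- rewrite pos_part_eq0 ?(ltW s0)// mulr0.
  have C : is_derive s 1 (fun=> 0 : R) 0 by exact: is_derive_cst.
  apply: near_eq_is_derive C.
  near=> x; rewrite pos_part_eq0 ?expr0n//.
  by apply/ltW; near: x; exact: lt_nbhsl.
- rewrite pos_part_id ?(ltW s0)//.
  have C := is_derive_sqr (is_derive_id s 1).
  rewrite mulr1 in C; apply: near_eq_is_derive C.
  near=> x; rewrite pos_part_id//.
  by apply/ltW; near: x; exact: lt_nbhsr.
- rewrite pos_part_eq0// mulr0.
  have H : h^-1 *: (pos_part (h *: 1 + 0) ^+ 2 - pos_part 0 ^+ 2) @[h --> (0 : R)^'] --> (0 : R).
    apply/cvgr0Pnorm_lt => e e0; near=> h.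
    rewrite /GRing.scale/= mulr1 addr0 (pos_part_eq0 (lexx 0)) expr0n/= subr0.
    apply: (@le_lt_trans _ _ `|h|).
      have [h0|h0] := leP h 0; first by rewrite pos_part_eq0// expr0n mulr0 normr0.
      by rewrite pos_part_id ?(ltW h0)// expr2 mulKf// gt_eqF.
    near: h; apply: dnbhs0_lt; exact: e0.
  apply: DeriveDef; first exact: cvgP H.
  exact: (cvg_lim (@Rhausdorff R) H).
Unshelve. all: by end_near. Qed.

Definition trunc_ratio e t : R := pos_part (t ^+ 2 - e ^+ 2) / (t ^+ 2 + e ^+ 2).

(* A C^1 odd truncation vanishing on [-e, e], close to the identity with its
   derivative away from 0. *)
Definition trunc e t : R := t * trunc_ratio e t ^+ 2.

(** Derivative of [trunc], with r the ratio: as 1 - r = 2 e^2 / (t^2 + e^2) for |t| >= e, the term 2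
    t r r' equals 4 t^2 / (t^2 + e^2) times r (1 - r). In this form it is bounded uniformly in e,
    and it tends to 1 as r does. *)
Definition dtrunc e t : R := trunc_ratio e t ^+ 2 +
  4 * (t ^+ 2 / (t ^+ 2 + e ^+ 2)) * trunc_ratio e t * (1 - trunc_ratio e t).

Lemma trunc_den_gt0 e t : 0 < e -> 0 < t ^+ 2 + e ^+ 2.
Proof. by move=> e0; rewrite ltr_wpDl ?sqr_ge0 ?exprn_gt0. Qed.

Lemma trunc_ratio01 e t : 0 < e -> 0 <= trunc_ratio e t <= 1.
Proof.
move=> e0; have D0 := trunc_den_gt0 t e0.
rewrite /trunc_ratio divr_ge0 ?pos_part_ge0 ?(ltW D0)//= ler_pdivrMr// mul1r.
have := sqr_ge0 t; have := sqr_ge0 e.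
have [h|/ltW h] := leP (t ^+ 2 - e ^+ 2) 0; first by rewrite pos_part_eq0//; lra.
by rewrite pos_part_id//; lra.
Qed.

Lemma trunc_ratio_small e t : `|t| < e -> trunc_ratio e t = 0.
Proof.
move=> te; have e0 : 0 <= e by rewrite (le_trans (normr_ge0 t))// ltW.
rewrite /trunc_ratio pos_part_eq0 ?mul0r// subr_le0 -(real_normK (num_real t)).
by rewrite lerXn2r ?nnegrE// ltW.
Qed.

(** At a fixed t != 0 the ratio tends to 1 at rate e^2, whence the pointwise convergence of the
    truncations and of their derivatives. *)
Lemma trunc_ratio_close e t : 0 < e -> t != 0 ->
  1 - trunc_ratio e t <= 2 / t ^+ 2 * e ^+ 2.
Proof.
move=> e0 t0; have D0 := trunc_den_gt0 t e0.
have t2 : 0 < t ^+ 2 by rewrite exprn_even_gt0.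
apply: (@le_trans _ _ (2 * e ^+ 2 / (t ^+ 2 + e ^+ 2))).
  rewrite /trunc_ratio ler_pdivlMr// mulrBl mul1r divfK ?gt_eqF//.
  by have := pos_part_ge (t ^+ 2 - e ^+ 2); lra.
rewrite [leRHS]mulrAC; apply: ler_wpM2l; first by rewrite mulr_ge0 ?sqr_ge0.
rewrite lef_pV2 ?posrE// lerDl.
exact: sqr_ge0.
Qed.

Lemma normr_trunc_sub e t : 0 < e ->
  `|trunc e t - t| <= 2 * `|t| * (1 - trunc_ratio e t).
Proof.
move=> e0; have /andP[r0 r1] := trunc_ratio01 t e0; rewrite /trunc.
set r := trunc_ratio e t in r0 r1 *.
have -> : t * r ^+ 2 - t = - (t * (1 - r) * (1 + r)) by ring.
rewrite normrN !normrM (ger0_norm (x := 1 - r)) ?subr_ge0// (ger0_norm (x := 1 + r)) ?addr_ge0//.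
rewrite [leRHS](_ : _ = `|t| * (1 - r) * 2); last by ring.
rewrite ler_wpM2l ?mulr_ge0 ?subr_ge0//; lra.
Qed.

(** The difference factors through 1 - r, with r the ratio; 6 is a crude bound for the other
    factor. *)
Lemma normr_dtrunc_sub e t : 0 < e ->
  `|dtrunc e t - 1| <= 6 * (1 - trunc_ratio e t).
Proof.
move=> e0; have /andP[r0 r1] := trunc_ratio01 t e0; rewrite /dtrunc.
have D0 := trunc_den_gt0 t e0.
set r := trunc_ratio e t in r0 r1 *.
have y0 : 0 <= t ^+ 2 / (t ^+ 2 + e ^+ 2) by rewrite divr_ge0 ?sqr_ge0// ltW.
have y1 : t ^+ 2 / (t ^+ 2 + e ^+ 2) <= 1.
  by rewrite ler_pdivrMr// mul1r lerDl sqr_ge0.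
set y := t ^+ 2 / _ in y0 y1 *.
have -> : r ^+ 2 + 4 * y * r * (1 - r) - 1 = (1 - r) * (4 * (y * r) - (1 + r)) by ring.
rewrite normrM ger0_norm ?subr_ge0// mulrC ler_wpM2r ?subr_ge0//.
have H0 : 0 <= y * r by rewrite mulr_ge0.
have H1 : y * r <= 1 by rewrite -[leRHS]mulr1; exact: ler_pM.
by rewrite ler_norml; apply/andP; split; lra.
Qed.

Lemma is_derive_trunc e t : 0 < e -> is_derive t 1 (trunc e) (dtrunc e t).
Proof.
move=> e0; have D0 := trunc_den_gt0 t e0.
pose A x : R := pos_part (x ^+ 2 - e ^+ 2) ^+ 2.
pose B x : R := (x ^+ 2 + e ^+ 2) ^+ 2.
have dsq c : is_derive t 1 (fun x => x ^+ 2 + c : R) (2 * t).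
  rewrite -[2 * t]addr0; apply: is_deriveD.
  by have := is_derive_sqr (is_derive_id t 1); rewrite mulr1.
have dA : is_derive t 1 A (2 * pos_part (t ^+ 2 - e ^+ 2) * (2 * t)).
  exact: (is_derive1_comp (is_derive_sqr_pos_part _) (dsq (- e ^+ 2))).
have dB : is_derive t 1 B (2 * (t ^+ 2 + e ^+ 2) * (2 * t)).
  exact: is_derive_sqr (dsq (e ^+ 2)).
have B0 : B t != 0 by rewrite /B expf_neq0// gt_eqF.
have := is_deriveM (is_derive_id t 1) (is_deriveM dA (is_deriveV B0 dB)).
have -> : id * (A * (fun x => (B x)^-1)) = trunc e.
  apply/funext => x; rewrite /trunc /trunc_ratio exprMn exprVn.
  by [].
move=> /is_derive_eq; apply.
rewrite /GRing.scale/= mulr1 [X in _ + X = _](_ : _ = A t / B t)//.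
rewrite /dtrunc /trunc_ratio /A /B; field.
by rewrite gt_eqF.
Qed.

Lemma dtrunc_continuous e : 0 < e -> continuous (dtrunc e).
Proof.
move=> e0 t; have D0 := trunc_den_gt0 t e0.
have c2 c : (x ^+ 2 + c : R) @[x --> t] --> t ^+ 2 + c.
  by apply: cvgD; [apply: cvg_exprn; exact: cvg_id|exact: cvg_cst].
have cV : (x ^+ 2 + e ^+ 2)^-1 @[x --> t] --> (t ^+ 2 + e ^+ 2)^-1.
  by apply: cvgV; [rewrite gt_eqF|exact: c2].
have cr : trunc_ratio e x @[x --> t] --> trunc_ratio e t.
  apply: cvgM; last exact: cV.
  apply: (@cvg_comp _ _ _ (fun x => x ^+ 2 - e ^+ 2) pos_part _
    (nbhs (t ^+ 2 - e ^+ 2))); [exact: c2|exact: pos_part_continuous].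
apply: cvgD; first exact: cvg_exprn.
apply: cvgM; last by apply: cvgB; [exact: cvg_cst|exact: cr].
apply: cvgM; last exact: cr.
apply: cvgM; first exact: cvg_cst.
by apply: cvgM; [apply: cvg_exprn; exact: cvg_id|exact: cV].
Qed.

End Truncation.

(** * From the explicit solution to a weak solution *)

Section WeakFormulation.
Context {R : realType}.
Local Notation mu := (@lebesgue_measure R).
Local Notation integrable01 f := (mu.-integrable I01 (EFin \o f)).
Implicit Types f df u d v dv w z phi : R -> R.
Hint Resolve measurable_I01 : core.

Lemma near_restrict_I01 f (a b x : R) : 0 < a -> b < 1 ->
  (forall y, I01 y -> ~~ (a <= y <= b) -> f y = 0) ->
  (I01 x /\ \forall y \near x, (f \_ I01) y = f y) \/
  (~ I01 x /\ \forall y \near x, (f \_ I01) y = 0).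
Proof.
move=> a0 b1 f0; have [Ix|nIx] := pselect (I01 x); [left|right]; split => //.
  have /andP[x0 x1] : 0 < x < 1 by have := Ix; rewrite /I01/= in_itv.
  near=> y; rewrite patchE mem_set// /I01/= in_itv/=; apply/andP; split; near: y.
    exact: lt_nbhsr.
  exact: lt_nbhsl.
have off y : ~~ (a <= y <= b) -> (f \_ I01) y = 0.
  by move=> yab; rewrite patchE; case: ifPn => //; rewrite inE => /f0; exact.
have [x0|x0] := leP x 0.
  near=> y; apply: off; rewrite negb_and -ltNge; apply/orP; left; near: y.
  by apply: lt_nbhsl; exact: le_lt_trans a0.
have x1 : 1 <= x.
  by rewrite leNgt; apply/negP => x1; apply: nIx; rewrite /I01/= in_itv/= x0.
near=> y; apply: off; rewrite negb_and -!ltNge; apply/orP; right; near: y.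
by apply: lt_nbhsr; exact: lt_le_trans x1.
Unshelve. all: by end_near. Qed.

(** A solution on the whole line need not vanish outside (0, 1), so its truncation has to be cut off
    there; the margin between [a, b] and the ends of (0, 1) keeps the cut from affecting
    differentiability. *)
Lemma test_function_restrict f df (a b : R) : 0 < a -> b < 1 -> continuous df ->
  (forall x : R, is_derive x 1 f (df x)) ->
  (forall y, I01 y -> ~~ (a <= y <= b) -> f y = 0 /\ df y = 0) ->
  test_function (f \_ I01) /\ derive1 (f \_ I01) = df \_ I01.
Proof.
move=> a0 b1 cdf fdf off.
have off1 y : I01 y -> ~~ (a <= y <= b) -> f y = 0 by move=> Iy /(off y Iy)[].
have off2 y : I01 y -> ~~ (a <= y <= b) -> df y = 0 by move=> Iy /(off y Iy)[].
have D (x : R) : is_derive x 1 (f \_ I01) ((df \_ I01) x).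
  have [[Ix H]|[Ix H]] := near_restrict_I01 x a0 b1 off1.
    rewrite patchE mem_set//; apply: near_eq_is_derive (fdf x).
    by near=> y; apply/esym; near: y.
  rewrite patchE memNset//.
  have C : is_derive x 1 (fun=> 0 : R) 0 by exact: is_derive_cst.
  apply: near_eq_is_derive C.
  by near=> y; apply/esym; near: y.
have E : derive1 (f \_ I01) = df \_ I01.
  by apply/funext => x; rewrite derive1E; have [] := D x.
split => //; split.
- by move=> x; have [] := D x.
- rewrite E => x; have [[Ix H]|[Ix H]] := near_restrict_I01 x a0 b1 off2.
    rewrite /continuous_at patchE mem_set//.
    apply: cvg_trans (cdf x); apply: near_eq_cvg.
    by near=> y; apply/esym; near: y.
  rewrite /continuous_at patchE memNset//.
  have C0 : (fun=> 0 : R) y @[y --> x] --> (0 : R) by exact: cvg_cst.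
  apply: cvg_trans C0.
  apply: near_eq_cvg; near=> y; apply/esym; near: y; exact: H.
- exists a, b; split => // x; rewrite in_itv/= => xab.
  by rewrite patchE; case: ifPn => //; rewrite inE => /off1; exact.
Unshelve. all: by end_near. Qed.

Lemma small_near_ends u (e : R) : continuous u -> u 0 = 0 -> u 1 = 0 -> 0 < e ->
  exists a b, [/\ 0 < a, b < 1 &
    forall y, I01 y -> ~~ (a <= y <= b) -> `|u y| < e].
Proof.
move=> cu u0 u1 e0.
have c x : u x = 0 -> \forall y \near x, `|u y| < e.
  move=> ux; have /cvgrPdist_lt/(_ e e0) := cu x; rewrite ux.
  by apply: filterS => y; rewrite sub0r normrN.
have [a /andP[a0 _] aP] := near_right_segment (c 0 u0) ltr01.
have [b /andP[_ b1] bP] := near_left_segment (c 1 u1) ltr01.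
exists a, b; split => // y; rewrite /I01/= in_itv/= => /andP[y0 y1].
rewrite negb_and -!ltNge => /orP[ya|yb]; first by apply: aP; rewrite !ltW.
by apply: bP; rewrite !ltW.
Qed.

Lemma integral_by_parts_test_function w z phi : (forall x : R, is_derive x 1 w (z x)) ->
  continuous z -> test_function phi ->
  \int[mu]_(x in I01) (w x * derive1 phi x) = - \int[mu]_(x in I01) (z x * phi x).
Proof.
move=> wz cz tphi; have [dphi cdphi _] := tphi.
have cw : continuous w by move=> x; exact: is_derive1_continuous (wz x).
have zi : integrable01 z by exact/L4_integrable/continuous_L4.
have di : integrable01 (derive1 phi) by exact/L4_integrable/continuous_L4.
have pz : continuous (primitive z) by exact: primitive_continuous.
have pzi : integrable01 (primitive z) by exact/L4_integrable/continuous_L4.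
have i1 := integrable01Z (w 0) di.
have i2 := integrable01_mul_continuous pzi cdphi.
rewrite (primitive_test_function zi tphi) opprK.
have -> : \int[mu]_(x in I01) (w x * derive1 phi x) =
    \int[mu]_(x in I01) (w 0 * derive1 phi x + primitive z x * derive1 phi x).
  apply: eq_Rintegral => x; rewrite inE /I01/= in_itv/= => /andP[x0 x1].
  have x01 : 0 <= x <= 1 by rewrite !ltW.
  by rewrite (primitive_derive cw cz (fun t _ => wz t) x01); ring.
rewrite RintegralD// RintegralZl// -(primitive_ge1 _ (lexx 1)).
have o1 : (0 : R) <= (1 : R) <= (1 : R) by rewrite ler01 lexx.
rewrite (test_function_primitive tphi o1).
by have [_ ->] := test_function_ends tphi; rewrite mulr0 add0r.
Qed.

(** As w and z are bounded on (0, 1), both sides are continuous in (v, dv) for the L1-norm, so the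
    identity passes from test functions to their limits. *)
Lemma integral_by_parts_W014 w z v dv : (forall x : R, is_derive x 1 w (z x)) ->
  continuous z -> W014 v dv ->
  \int[mu]_(x in I01) (w x * dv x) = - \int[mu]_(x in I01) (z x * v x).
Proof.
move=> wz cz [[vL dvL _] [phi [tphi phiv dphidv]]].
have cw : continuous w by move=> x; exact: is_derive1_continuous (wz x).
have vi := L4_integrable vL; have dvi := L4_integrable dvL.
have cphi n : continuous (phi n) by exact: test_function_continuous.
have cdphi n : continuous (derive1 (phi n)) by have [] := tphi n.
have [M1 M10 wM] := continuous_bounded_I01 cw.
have [M2 M20 zM] := continuous_bounded_I01 cz.
have close f g h (M e : R) : continuous f -> (forall x, I01 x -> `|f x| <= M) ->
    0 < M -> continuous g -> integrable01 h ->
    \int[mu]_(x in I01) `|g x - h x| <= e ->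
    `|\int[mu]_(x in I01) (f x * g x) - \int[mu]_(x in I01) (f x * h x)| <= M * e.
  move=> cf fM M0 cg hi ghe.
  have gi : integrable01 g by exact/L4_integrable/continuous_L4.
  have fgi : integrable01 (fun x => f x * g x).
    apply: eq_integrable01 (integrable01_mul_continuous gi cf) => x _; exact: mulrC.
  have fhi : integrable01 (fun x => f x * h x).
    apply: eq_integrable01 (integrable01_mul_continuous hi cf) => x _; exact: mulrC.
  have ghi := integrable_norm (integrable01B gi hi).
  rewrite -RintegralB//.
  apply: le_trans (le_normr_Rintegral measurable_I01 (integrable01B fgi fhi)) _.
  apply: (@le_trans _ _ (\int[mu]_(x in I01) (M * `|g x - h x|))).
    apply: le_Rintegral => //.
    - exact: (integrable_norm (integrable01B fgi fhi)).
    - exact: (integrable01Z M ghi).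
    - by move=> x Ix; rewrite -mulrBr normrM ler_wpM2r// fM.
  by rewrite RintegralZl// ler_wpM2l// ltW.
have m1 n : measurable_fun I01 (fun x => phi n x - v x).
  apply: measurable_funB; first exact: continuous_measurable_I01.
  exact: measurable_integrable01.
have m2 n : measurable_fun I01 (fun x => derive1 (phi n) x - dv x).
  apply: measurable_funB; first exact: continuous_measurable_I01.
  exact: measurable_integrable01.
apply/eqP; rewrite -subr_eq0 opprK -normr_le0; apply/ler_addgt0Pl => e e0; rewrite addr0.
pose e' := e / (M1 + M2).
have e'0 : 0 < e' by rewrite divr_gt0// addr_gt0.
have [N _ H] : \forall n \near \oo, \int[mu]_(x in I01) `|phi n x - v x| <= e' /\
    \int[mu]_(x in I01) `|derive1 (phi n) x - dv x| <= e'.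
  apply: filterS2 (L4norm_cvg0_L1 m1 phiv e'0) (L4norm_cvg0_L1 m2 dphidv e'0).
  by move=> n [_ H1] [_ H2].
have [H1 H2] := H N (leqnn N).
have C1 := close z (phi N) v M2 e' cz zM M20 (cphi N) vi H1.
have C2 := close w (derive1 (phi N)) dv M1 e' cw wM M10 (cdphi N) dvi H2.
have E := integral_by_parts_test_function wz cz (tphi N).
rewrite [leRHS](_ : e = M1 * e' + M2 * e'); last first.
  by rewrite /e'; field; rewrite gt_eqF// addr_gt0.
rewrite E in C2; apply: le_trans (lerD C2 C1).
have G (a b c : R) : a + b = - ((- c - a) + (c - b)) by ring.
rewrite (G _ _ (\int[mu]_(x in I01) (z x * phi N x))) normrN; exact: ler_normD.
Qed.

Lemma cvg0_le_harmonic_sqr (f : nat -> R) (C : R) :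
  (forall n, `|f n| <= C * (n.+1%:R^-1) ^+ 2) -> f n @[n --> \oo] --> 0.
Proof.
move=> fC; apply/cvgr0Pnorm_lt => e e0.
have H : C * (n.+1%:R^-1) ^+ 2 @[n --> \oo] --> (0 : R).
  rewrite -[0](mulr0 C) -[0](expr0n R 2); apply: cvgM; first exact: cvg_cst.
  apply: cvg_exprn; exact: cvg_harmonic.
have /cvgr0Pnorm_lt/(_ e e0) := H; apply: filterS => n.
by apply: le_lt_trans; apply: le_trans (ler_norm _); exact: fC.
Qed.

(** The approximants are [trunc (e n) \o u] with e n = 1 / n.+1, which vanish near 0 and 1 because u
    is small there. Wherever u is nonzero, they and their derivatives converge to u and d; together
    with uniform bounds, convergence almost everywhere is enough. *)
Lemma C1_W014 u d : (forall x : R, is_derive x 1 u (d x)) -> continuous d ->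
  u 0 = 0 -> u 1 = 0 -> {ae mu, forall x, I01 x -> u x != 0} -> W014 u d.
Proof.
move=> ud cd u0 u1 un0.
have cu : continuous u by move=> x; exact: is_derive1_continuous (ud x).
have [Mu Mu0 uM] := continuous_bounded_I01 cu.
have [Md Md0 dM] := continuous_bounded_I01 cd.
split; first split; [exact: continuous_L4|exact: continuous_L4| |].
  by move=> phi tphi; exact: integral_by_parts_test_function.
pose e n : R := n.+1%:R^-1.
have e0 n : 0 < e n by rewrite invr_gt0 ltr0Sn.
pose f n := trunc (e n) \o u; pose df n x := dtrunc (e n) (u x) * d x.
have H n : test_function (f n \_ I01) /\ derive1 (f n \_ I01) = df n \_ I01.
  have [a [b [a0 b1 ab]]] := small_near_ends cu u0 u1 (e0 n).
  apply: (test_function_restrict a0 b1).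
  - move=> x; apply: cvgM; last exact: cd.
    apply: (@cvg_comp _ _ _ u (dtrunc (e n)) _ (nbhs (u x))); first exact: cu.
    exact: dtrunc_continuous.
  - by move=> x; apply: is_derive1_comp; exact: is_derive_trunc.
  - move=> y Iy yab; have r0 := trunc_ratio_small (ab y Iy yab).
    by rewrite /f /df /= /trunc /dtrunc r0 expr0n/= !mulr0 !mul0r add0r mul0r.
have sub1 n x : 1 - trunc_ratio (e n) x <= 1.
  by rewrite lerBlDr lerDl; have /andP[] := trunc_ratio01 x (e0 n).
have sub0 n x : 0 <= 1 - trunc_ratio (e n) x.
  by rewrite subr_ge0; have /andP[] := trunc_ratio01 x (e0 n).
exists (fun n => f n \_ I01); split.
- by move=> n; have [] := H n.
- apply: (@bounded_pointwise_L4norm_cvg0 _ _ (2 * Mu)).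
  + move=> n; apply: measurable_funB; last exact: continuous_measurable_I01.
    apply: continuous_measurable_I01; apply: test_function_continuous; exact: (H n).1.
  + move=> n x Ix; rewrite patchE mem_set//; apply: le_trans (normr_trunc_sub _ (e0 n)) _.
    rewrite -[leRHS]mulr1; apply: ler_pM; [|exact: sub0| |exact: sub1].
      by rewrite mulr_ge0.
    by rewrite ler_wpM2l// uM.
  + apply: lebesgue_aeS un0 => x ux Ix; have {}ux := ux Ix.
    apply: (@cvg0_le_harmonic_sqr _ (2 * `|u x| * (2 / u x ^+ 2))) => n.
    rewrite patchE mem_set//; apply: le_trans (normr_trunc_sub _ (e0 n)) _.
    rewrite -(mulrA (2 * `|u x|)); apply: ler_wpM2l; first by rewrite mulr_ge0.
    exact: trunc_ratio_close.
- apply: (@bounded_pointwise_L4norm_cvg0 _ _ (6 * Md)).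
  + move=> n; apply: measurable_funB; last exact: continuous_measurable_I01.
    by apply: continuous_measurable_I01; have [[]] := H n.
  + move=> n x Ix; have [_ ->] := H n; rewrite patchE mem_set// /df.
    rewrite -[X in _ - X]mul1r -mulrBl normrM; apply: ler_pM => //; last exact: dM.
    apply: le_trans (normr_dtrunc_sub _ (e0 n)) _.
    by rewrite -[leRHS]mulr1 ler_wpM2l.
  + apply: lebesgue_aeS un0 => x ux Ix; have {}ux := ux Ix.
    apply: (@cvg0_le_harmonic_sqr _ (`|d x| * 6 * (2 / u x ^+ 2))) => n.
    have [_ ->] := H n; rewrite patchE mem_set// /df.
    rewrite -[X in _ - X]mul1r -mulrBl normrM mulrC -!mulrA; apply: ler_wpM2l => //.
    apply: le_trans (normr_dtrunc_sub _ (e0 n)) _; apply: ler_wpM2l => //.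
    by rewrite mulrA; exact: trunc_ratio_close.
Qed.

Lemma arithmetic_zeros_ae u (J : R) : (forall x, 0 <= x -> u x = 0 ->
  exists n : nat, x = n%:R * J) -> {ae mu, forall x, I01 x -> u x != 0}.
Proof.
move=> uz; pose A := [set n%:R * J | n in [set: nat]] : set (measurableTypeR R).
have cA : countable A by exact: card_image_le.
exists A; split.
- by apply: countable_measurable => // t; exact: measurable_set1.
- exact: countable_lebesgue_measure0.
- move=> x /= nx; apply: contrapT => nA; apply: nx => Ix; apply/eqP => ux.
  apply: nA; have [|n ->] := uz x _ ux; last by exists n.
  by move: Ix; rewrite /I01/= in_itv/= => /andP[/ltW].
Qed.

(** The condition on [n] puts a zero of the whole-line solution at 1. The weak equation is
    integration by parts against the flux, whose derivative is then rewritten in terms of k and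
    lambda; the solution is nontrivial because its zeros in (0, 1) form a null set. *)
Lemma eigen_parameters_of_period (lambda k q : R) n : 0 < q ->
  lambda = k ^+ 4 + 3 * q ^+ 2 -> 1 = n%:R * half_period (k ^+ 2 / 3) q ->
  eigen_parameters lambda k.
Proof.
move=> q0 lE J1; have m0 : 0 <= k ^+ 2 / 3 by rewrite divr_ge0 ?sqr_ge0.
have [u [d [ud cd wz uz zu]]] := arc_solution m0 q0.
have cu : continuous u by move=> x; exact: is_derive1_continuous (ud x).
have u0 : u 0 = 0 by have := uz 0%N; rewrite mul0r.
have u1 : u 1 = 0 by rewrite J1 uz.
have un0 := arithmetic_zeros_ae zu.
have W := C1_W014 ud cd u0 u1 un0.
exists u; last first.
  move=> triv; have [] := @ae_I01_nonempty R (fun x => u x = 0 /\ u x != 0).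
    by apply: lebesgue_aeS2 triv un0 => x H1 H2 Ix; split; [exact: H1|exact: H2].
  by move=> x _ [->]; rewrite eqxx.
exists d => // v dv Wv; have [[vL dvL _] _] := Wv.
have uL := continuous_L4 cu; have dL := continuous_L4 cd.
pose z x := - 3 * q ^+ 2 * u x ^+ 3 + 3 * (k ^+ 2 / 3) * u x * d x ^+ 2.
have cz : continuous z.
  move=> x; apply: cvgD; apply: cvgM.
  - exact: cvg_cst.
  - exact: cvg_exprn (cu x).
  - by apply: cvgM; [exact: cvg_cst|exact: cu].
  - exact: cvg_exprn (cd x).
have P := integral_by_parts_W014 wz cz Wv.
have E : \int[mu]_(x in I01) ((k ^+ 2 * u x ^+ 2 + d x ^+ 2) * d x * dv x) =
    - \int[mu]_(x in I01) (z x * v x).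
  by rewrite -P; apply: eq_Rintegral => x _; field.
have i1 : integrable01 (fun x => u x ^+ 3 * v x).
  by apply: eq_integrable01 (L4_integrable_mul4 uL uL uL vL) => x _; ring.
have i2 : integrable01 (fun x => u x * d x ^+ 2 * v x).
  by apply: eq_integrable01 (L4_integrable_mul4 uL dL dL vL) => x _; ring.
have -> : \int[mu]_(x in I01) ((k ^+ 2 * u x ^+ 2 + d x ^+ 2) * u x * v x) =
    k ^+ 2 * \int[mu]_(x in I01) (u x ^+ 3 * v x) + \int[mu]_(x in I01) (u x * d x ^+ 2 * v x).
  rewrite -RintegralZl// -RintegralD//; last exact: integrable01Z.
  by apply: eq_Rintegral => x _; ring.
have E2 : \int[mu]_(x in I01) (z x * v x) =
    k ^+ 2 * \int[mu]_(x in I01) (u x * d x ^+ 2 * v x) -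
    3 * q ^+ 2 * \int[mu]_(x in I01) (u x ^+ 3 * v x).
  rewrite -!RintegralZl// -RintegralB//; try exact: integrable01Z.
  by apply: eq_Rintegral => x _; rewrite /z; field.
by rewrite E E2 lE; ring.
Qed.

End WeakFormulation.

(** * Explicit eigenvalues and their dependence on n and k *)

Section Spectrum.
Context {R : realType}.
Implicit Types (k lambda m q : R) (n : nat).

(** Indices start at 0 while the number of arches starts at 1, hence [n.+1]. *)
Definition wave_sqr n : R := (n.+1%:R * pi) ^+ 2.

(** The positive root q of 2 q^2 = w (q + m), where w is [wave_sqr n] and m = k^2 / 3. *)
Definition nth_amplitude n k : R :=
  (wave_sqr n + Num.sqrt (wave_sqr n ^+ 2 + 8 * wave_sqr n * (k ^+ 2 / 3))) / 4.

Definition nth_eigenvalue n k : R := k ^+ 4 + 3 * nth_amplitude n k ^+ 2.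

Lemma wave_sqr_gt0 n : 0 < wave_sqr n.
Proof. by rewrite exprn_gt0// mulr_gt0 ?pi_gt0 ?ltr0Sn. Qed.

Lemma wave_sqr_lt n n' : (n < n')%N -> wave_sqr n < wave_sqr n'.
Proof.
move=> nn'; rewrite /wave_sqr ltrXn2r// ?nnegrE ?mulr_ge0 ?pi_ge0//.
by rewrite ltr_pM2r ?pi_gt0// ltr_nat.
Qed.

Lemma period_wave_sqr n m q : 0 <= m -> 0 < q ->
  1 = n.+1%:R * half_period m q <-> 2 * q ^+ 2 = wave_sqr n * (q + m).
Proof.
move=> m0 q0; rewrite /half_period; set s := Num.sqrt _.
have s2 : s ^+ 2 = (q + m) / 2 by rewrite sqr_sqrtr// divr_ge0// addr_ge0// ltW.
have s0 : 0 <= s by exact: sqrtr_ge0.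
have -> : wave_sqr n * (q + m) = 2 * (n.+1%:R * pi * s) ^+ 2.
  by rewrite exprMn s2 /wave_sqr; field.
have c0 : 0 <= n.+1%:R * pi * s by rewrite !mulr_ge0// pi_ge0.
have E : n.+1%:R * (pi * s / q) = n.+1%:R * pi * s / q by rewrite !mulrA.
rewrite E; split => [H|H].
  by have := congr1 ( *%R^~ q) H; rewrite /= mul1r divfK ?gt_eqF// => <-.
have /eqP : q ^+ 2 = (n.+1%:R * pi * s) ^+ 2 by lra.
rewrite eqrXn2// ?ltW// => /eqP <-.
by rewrite divff// gt_eqF.
Qed.

Lemma wave_sqr_le_sqrt n k :
  wave_sqr n <= Num.sqrt (wave_sqr n ^+ 2 + 8 * wave_sqr n * (k ^+ 2 / 3)).
Proof.
have N0 := ltW (wave_sqr_gt0 n).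
rewrite -{1}(ger0_norm N0) -sqrtr_sqr ler_wsqrtr// lerDl.
by apply: mulr_ge0; [apply: mulr_ge0|rewrite divr_ge0 ?sqr_ge0].
Qed.

Lemma nth_amplitude_ge n k : wave_sqr n / 2 <= nth_amplitude n k.
Proof. by have := wave_sqr_le_sqrt n k; rewrite /nth_amplitude; lra. Qed.

Lemma nth_amplitude_gt0 n k : 0 < nth_amplitude n k.
Proof. by have := nth_amplitude_ge n k; have := wave_sqr_gt0 n; lra. Qed.

Lemma nth_amplitude_root n k :
  2 * nth_amplitude n k ^+ 2 = wave_sqr n * (nth_amplitude n k + k ^+ 2 / 3).
Proof.
rewrite /nth_amplitude; set N := wave_sqr n; set S := Num.sqrt _.
have N0 := wave_sqr_gt0 n; have k0 : 0 <= k ^+ 2 / 3 by rewrite divr_ge0 ?sqr_ge0.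
have : S ^+ 2 = N ^+ 2 + 8 * N * (k ^+ 2 / 3).
  by rewrite sqr_sqrtr// addr_ge0 ?sqr_ge0// mulr_ge0// mulr_ge0// ltW.
rewrite -/N => E; have -> : ((N + S) / 4) ^+ 2 = (N ^+ 2 + 2 * N * S + S ^+ 2) / 16 by field.
by rewrite E; field.
Qed.

Lemma nth_amplitude_unique n k q : 0 < q ->
  2 * q ^+ 2 = wave_sqr n * (q + k ^+ 2 / 3) -> q = nth_amplitude n k.
Proof.
move=> q0 H; have Ea := nth_amplitude_root n k; have ga := nth_amplitude_ge n k.
have N0 := wave_sqr_gt0 n.
(* The two quadratic equations subtract to this product. Its second factor is positive, because q >
   0 and [nth_amplitude n k] is at least half of [wave_sqr n]. *)
have /eqP : (q - nth_amplitude n k) * (2 * (q + nth_amplitude n k) - wave_sqr n) = 0.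
  rewrite (_ : _ * _ = (2 * q ^+ 2 - wave_sqr n * q) -
    (2 * nth_amplitude n k ^+ 2 - wave_sqr n * nth_amplitude n k)); last by ring.
  by rewrite H Ea; ring.
rewrite mulf_eq0 => /orP[|/eqP]; first by rewrite subr_eq0 => /eqP.
lra.
Qed.

Lemma eigen_parametersE lambda k :
  eigen_parameters lambda k <-> exists n, lambda = nth_eigenvalue n k.
Proof.
have m0 : 0 <= k ^+ 2 / 3 by rewrite divr_ge0 ?sqr_ge0.
split=> [[u su nu]|[n ->]].
  have [q [q0 -> [U [D [cUD nz]]]]] := weak_solution_classical su nu.
  have [n /(period_wave_sqr _ m0 q0) Hn] := classical_solution_period m0 q0 cUD nz.
  by exists n; rewrite /nth_eigenvalue -(nth_amplitude_unique q0 Hn).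
apply: (@eigen_parameters_of_period _ _ _ (nth_amplitude n k) n.+1) => //.
  exact: nth_amplitude_gt0.
by apply/period_wave_sqr => //; [exact: nth_amplitude_gt0|exact: nth_amplitude_root].
Qed.

Lemma exprn4_lt_eigenvalue n k : k ^+ 4 < nth_eigenvalue n k.
Proof. by rewrite /nth_eigenvalue ltrDl mulr_gt0// exprn_gt0// nth_amplitude_gt0. Qed.

Lemma nth_eigenvalue_gt0 n k : 0 < nth_eigenvalue n k.
Proof. by apply: le_lt_trans (exprn4_lt_eigenvalue n k); rewrite exprn_even_ge0. Qed.

(** With q the amplitude, q >= [wave_sqr n] / 2 >= n.+1 since pi^2 >= 2, and 3 q^2 >= q. This gives
    both the divergence of the eigenvalues and, for fixed lambda, a finite range of indices to
    inspect. *)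
Lemma succn_le_eigenvalue n k : n.+1%:R <= nth_eigenvalue n k.
Proof.
have n1 : 1 <= n.+1%:R :> R by rewrite ler1n.
have qn : n.+1%:R <= nth_amplitude n k.
  apply: le_trans (nth_amplitude_ge n k); rewrite /wave_sqr exprMn.
  have p2 : 2 <= (pi : R) ^+ 2.
    by have := @pi_ge2 R; rewrite expr2; nra.
  nra.
have q1 : 1 <= nth_amplitude n k by exact: le_trans qn.
have k4 : 0 <= k ^+ 4 by rewrite exprn_even_ge0.
rewrite /nth_eigenvalue; nra.
Qed.

Lemma nth_amplitude_le n k k' : k ^+ 2 <= k' ^+ 2 -> nth_amplitude n k <= nth_amplitude n k'.
Proof.
move=> kk; have N0 := ltW (wave_sqr_gt0 n).
rewrite /nth_amplitude ler_pM2r ?invr_gt0// lerD2l ler_wsqrtr// lerD2l.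
by apply: ler_wpM2l; [apply: mulr_ge0|rewrite ler_pM2r ?invr_gt0].
Qed.

Lemma nth_eigenvalue_mono n k k' : 0 <= k -> k < k' -> nth_eigenvalue n k < nth_eigenvalue n k'.
Proof.
move=> k0 kk'; have k'0 : 0 <= k' by rewrite (le_trans k0)// ltW.
apply: ltr_leD; first by rewrite ltrXn2r.
have P := ltW (nth_amplitude_gt0 n _); rewrite ler_pM2l// lerXn2r ?nnegrE//.
by apply: nth_amplitude_le; apply/ltW; rewrite ltrXn2r.
Qed.

Lemma nth_eigenvalue_inj n k k' : 0 <= k -> 0 <= k' ->
  nth_eigenvalue n k = nth_eigenvalue n k' -> k = k'.
Proof.
move=> k0 k'0 E; have [kk|kk|//] := ltrgtP k k'.
  by have := nth_eigenvalue_mono n k0 kk; rewrite E ltxx.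
by have := nth_eigenvalue_mono n k'0 kk; rewrite E ltxx.
Qed.

Lemma nth_eigenvalue_ge0 n k : nth_eigenvalue n 0 <= nth_eigenvalue n k.
Proof.
rewrite /nth_eigenvalue expr0n/= lerD ?exprn_even_ge0//.
have P := ltW (nth_amplitude_gt0 n _); rewrite ler_pM2l// lerXn2r ?nnegrE//.
by apply: nth_amplitude_le; rewrite expr0n sqr_ge0.
Qed.

Lemma nth_eigenvalue_ltn n n' k : (n < n')%N -> nth_eigenvalue n k < nth_eigenvalue n' k.
Proof.
move=> nn'; rewrite /nth_eigenvalue ltrD2l ltr_pM2l// ltrXn2r// ?nnegrE ?ltW ?nth_amplitude_gt0//.
have N := wave_sqr_lt nn'; have N0 := wave_sqr_gt0 n.
rewrite /nth_amplitude ltr_pM2r ?invr_gt0//; apply: ltr_leD => //.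
have k0 : 0 <= k ^+ 2 / 3 by rewrite divr_ge0 ?sqr_ge0.
apply: ler_wsqrtr; apply: lerD; first by rewrite lerXn2r ?nnegrE// ltW// (lt_trans N0).
by apply: ler_wpM2r => //; rewrite ler_pM2l// ltW.
Qed.

Lemma nth_eigenvalue_leq n n' k : (n <= n')%N -> nth_eigenvalue n k <= nth_eigenvalue n' k.
Proof.
by rewrite leq_eqVlt => /predU1P[->//|nn']; exact/ltW/nth_eigenvalue_ltn.
Qed.

Lemma nth_eigenvalue_injn n n' k : nth_eigenvalue n k = nth_eigenvalue n' k -> n = n'.
Proof.
move=> E; have [nn|nn|//] := ltngtP n n'.
  by have := nth_eigenvalue_ltn k nn; rewrite E ltxx.
by have := nth_eigenvalue_ltn k nn; rewrite E ltxx.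
Qed.

Lemma nth_eigenvalue_continuous n : continuous (nth_eigenvalue n).
Proof.
move=> k; have c2 : x ^+ 2 / 3 @[x --> k] --> k ^+ 2 / 3.
  by apply: cvgM; [apply: cvg_exprn; exact: cvg_id|exact: cvg_cst].
apply: cvgD; first by apply: cvg_exprn; exact: cvg_id.
apply: cvgM; first exact: cvg_cst.
apply: cvg_exprn; apply: cvgM; last exact: cvg_cst.
apply: cvgD; first exact: cvg_cst.
pose h x := wave_sqr n ^+ 2 + 8 * wave_sqr n * (x ^+ 2 / 3).
apply: (@cvg_comp _ _ _ h Num.sqrt _ (nbhs (h k))); last exact: sqrt_continuous.
by apply: cvgD; [exact: cvg_cst|apply: cvgM; [exact: cvg_cst|exact: c2]].
Qed.

Lemma nth_eigenvalue_onto n lambda : nth_eigenvalue n 0 <= lambda ->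
  exists2 k, 0 <= k & nth_eigenvalue n k = lambda.
Proof.
move=> nl; have l0 : 0 < lambda by exact: lt_le_trans (nth_eigenvalue_gt0 n 0) nl.
have b0 : 0 <= 1 + lambda by rewrite addr_ge0// ltW.
(* The right end of the interval is large enough because (1 + lambda)^4 >= 1 + lambda. *)
have nb : lambda <= nth_eigenvalue n (1 + lambda).
  apply/ltW; apply: le_lt_trans (exprn4_lt_eigenvalue _ _).
  apply: (@le_trans _ _ (1 + lambda)); first by rewrite lerDr.
  by apply: ler_eXnr => //; rewrite lerDl ltW.
have c : {within `[0, 1 + lambda], continuous (nth_eigenvalue n)}.
  exact/continuous_subspaceT/nth_eigenvalue_continuous.
have [|k] := IVT (v := lambda) b0 c.
  by rewrite ge_min le_max nl nb orbT.
by rewrite in_itv/= => /andP[k0 _] E; exists k.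
Qed.

(** Monotonicity in k leaves at most one candidate. The default 0 occurs without a solution only if
    [nth_eigenvalue n 0 > lambda], and such indices are filtered out of the list below. *)
Definition eigen_parameter lambda n : R :=
  xget 0 [set k | 0 <= k /\ nth_eigenvalue n k = lambda].

Lemma eigen_parameterP lambda n : nth_eigenvalue n 0 <= lambda ->
  0 <= eigen_parameter lambda n /\ nth_eigenvalue n (eigen_parameter lambda n) = lambda.
Proof.
move=> /nth_eigenvalue_onto[k k0 E].
exact: (@xgetI _ 0 [set k | 0 <= k /\ nth_eigenvalue n k = lambda] k (conj k0 E)).
Qed.

(** The cut at [Num.truncn lambda] loses no index, since n.+1 <= [nth_eigenvalue n 0]. *)
Definition eigen_parameter_seq lambda : seq R :=
  [seq eigen_parameter lambda n | n <- iota 0 (Num.truncn lambda).+1 &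
    nth_eigenvalue n 0 <= lambda].

Lemma mem_eigen_indices lambda n :
  (n \in [seq n <- iota 0 (Num.truncn lambda).+1 | nth_eigenvalue n 0 <= lambda]) =
  (nth_eigenvalue n 0 <= lambda).
Proof.
rewrite mem_filter mem_iota leq0n/= add0n; case: leP => //= nl.
rewrite ltnS truncn_ge_nat; last exact: le_trans (ltW (nth_eigenvalue_gt0 n 0)) nl.
apply: le_trans nl; apply: le_trans (succn_le_eigenvalue n 0).
by rewrite ler_nat.
Qed.

Lemma eigen_parameter_seqP lambda k :
  k \in eigen_parameter_seq lambda <-> 0 <= k /\ eigen_parameters lambda k.
Proof.
split=> [/mapP[n]|[k0 /eigen_parametersE[n lE]]].
  rewrite mem_eigen_indices => /eigen_parameterP[k0 E] ->; split => //.
  by apply/eigen_parametersE; exists n.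
have n0 : nth_eigenvalue n 0 <= lambda by rewrite lE nth_eigenvalue_ge0.
apply/mapP; exists n; first by rewrite mem_eigen_indices.
have [k'0 E] := eigen_parameterP n0.
by apply: (@nth_eigenvalue_inj n) => //; rewrite E.
Qed.

(** If two indices gave the same k, they would give the same eigenvalue at this k, and eigenvalues
    at fixed k are strictly increasing in the index. *)
Lemma eigen_parameter_seq_uniq lambda : uniq (eigen_parameter_seq lambda).
Proof.
rewrite map_inj_in_uniq ?filter_uniq ?iota_uniq// => n n'.
rewrite !mem_eigen_indices => /eigen_parameterP[_ E] /eigen_parameterP[_ E'] H.
by apply: (@nth_eigenvalue_injn n n' (eigen_parameter lambda n)); rewrite E H E'.
Qed.

(** Eigenvalues at k = 0 increase with the index, so all of 0, ..., n pass the filter, which makes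
    n.+1 entries. *)
Lemma eigen_parameter_seq_size lambda n : nth_eigenvalue n 0 <= lambda ->
  (n < size (eigen_parameter_seq lambda))%N.
Proof.
move=> nl; rewrite size_map -[X in (X < _)%N](size_iota 0 n) -[X in (X < _)%N]/(size _).
rewrite (size_iota 0 n) -(size_iota 0 n.+1); apply: uniq_leq_size; first exact: iota_uniq.
move=> i; rewrite mem_iota leq0n/= add0n ltnS mem_eigen_indices => i_n.
by apply: le_trans nl; exact: nth_eigenvalue_leq.
Qed.

Lemma eigen_parameter_le lambda k : 0 <= k -> eigen_parameters lambda k ->
  k <= lambda `^ 4^-1.
Proof.
move=> k0 /eigen_parametersE[n lE].
rewrite -[leLHS](_ : (k ^+ 4) `^ 4^-1 = k); last first.
  by rewrite -powR_mulrn// -powRrM divff// powRr1.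
apply: ge0_ler_powR; rewrite ?nnegrE ?exprn_ge0//.
  by rewrite lE ltW// nth_eigenvalue_gt0.
by rewrite lE ltW// exprn4_lt_eigenvalue.
Qed.

End Spectrum.

Theorem theorem3p1 (R : realType) :
  [/\ (forall lambda k : R, k != 0 -> eigen_parameters lambda k ->
         k ^+ 4 < lambda),
      (forall k : R, exists lambda : nat -> R,
         [/\ forall n, 0 < lambda n,
             lambda n @[n --> \oo] --> +oo &
             [set l | eigen_parameters l k] = range lambda]) &
      exists lambdastar : R,
        [/\ 0 < lambdastar,
            (exists ks : R -> seq R,
               (forall lambda, lambdastar <= lambda ->
                  [/\ ks lambda != [::],
                      uniq (ks lambda),
                      [set k | 0 <= k /\ eigen_parameters lambda k]
                        = [set` ks lambda] &
                      forall k, k \in ks lambda ->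
                        0 <= k <= lambda `^ (4^-1)])
               /\ (size (ks lambda) @[lambda --> +oo] --> \oo)) &
            (forall lambda k : R, lambda < lambdastar ->
               forall u : R -> R, is_solution lambda k u -> trivial u)]].

Proof.
split.
- move=> lambda k _ /eigen_parametersE[n ->]; exact: exprn4_lt_eigenvalue.
- move=> k; exists (nth_eigenvalue ^~ k); split.
  + by move=> n; exact: nth_eigenvalue_gt0.
  + apply/cvgryPge => A; have := nbhs_infty_ger A; apply: filterS => n An.
    apply: le_trans An _; apply: le_trans (succn_le_eigenvalue n k).
    by rewrite ler_nat.
  + apply/seteqP; split => [l /= /eigen_parametersE[n ->]|l [n _ <-]/=].
      by exists n.
    by apply/eigen_parametersE; exists n.
- exists (nth_eigenvalue 0 0); split; first exact: nth_eigenvalue_gt0.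
  + exists eigen_parameter_seq; split=> [lambda l0|].
      split.
      * by rewrite -size_eq0 -lt0n eigen_parameter_seq_size.
      * exact: eigen_parameter_seq_uniq.
      * by apply/seteqP; split=> k /eigen_parameter_seqP.
      * move=> k /eigen_parameter_seqP[k0 Ek].
        by rewrite k0 eigen_parameter_le.
    (* Here [A] serves as an index: once lambda >= [nth_eigenvalue A 0], the list has more than [A]
       entries. *)
    apply/cvgnyPge => A; near=> lambda; apply/ltnW/eigen_parameter_seq_size.
    by near: lambda; apply: nbhs_pinfty_ge; exact: num_real.
  (* [nth_eigenvalue 0 0] is the minimum of all eigenvalues, over both the index and k. *)
  + move=> lambda k ll u su; apply: contrapT => nu.
    have /eigen_parametersE[n lE] : eigen_parameters lambda k by exists u.
    move: ll; rewrite ltNge lE => /negP; apply.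
    by apply: le_trans (nth_eigenvalue_ge0 n k); exact: nth_eigenvalue_leq.
Unshelve. all: by end_near. Qed.
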